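(* Let $d \ge 2$. For every $c>0$ there is a constant $C$, depending only on $d$ and $c$, such that for every well-distributed set $P \subset \mathbb{R}^d$ of size $n$ with separation constant $c$, $$\#\left\{(p,p') \in P \times P : \operatorname{dist}(|p-p'|, \mathbb{Z}) < n^{-\frac{d-1}{d(d+1)}}\right\} \le C\, n^{2-\frac{2}{d+1}+\frac{1}{d}} = C\, n^{2-\frac{1}{d}} \cdot n^{\frac{2}{d(d+1)}}.$$
   Context: A set $P \subset \mathbb{R}^d$ of size $n$ is called well-distributed with separation constant $c>0$ if $|p-p'| \ge c$ for all distinct $p,p' \in P$ (where $|\cdot|$ is the Euclidean norm) and every unit lattice cube contained in $[0,n^{1/d}]^d$ contains exactly one point of $P$. A unit lattice cube is a cube of the form $z+[0,1)^d$ with $z \in \mathbb{Z}^d$; it counts as contained in $[0,n^{1/d}]^d$ if it is a subset of it. For a real number $r$, $\operatorname{dist}(r,\mathbb{Z}) = \min_{m \in \mathbb{Z}} |r-m|$. *)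

(* Defs.v *)
From HB Require Import structures.
From mathcomp Require Import all_boot all_order all_algebra.
From mathcomp Require Import finmap.
From mathcomp Require Import all_classical all_reals all_analysis.
Set Implicit Arguments.
Unset Strict Implicit.
Unset Printing Implicit Defensive.
Import Order.TTheory GRing.Theory Num.Theory.
Local Open Scope fset_scope.
Local Open Scope classical_set_scope.
Local Open Scope ring_scope.

(* The library norm `|x| on row vectors is the sup norm, hence this one. *)
Definition euclidean_norm (R : realType) (d : nat) (x : 'rV[R]_d) : R :=
  Num.sqrt (\sum_(i < d) x ord0 i ^+ 2).

(* The infimum is a minimum: only the integers around r compete. *)
Definition dist_int (R : realType) (r : R) : R :=
  inf [set `|r - m%:~R| | m in [set: int]].

Definition unit_lattice_cube (R : realType) (d : nat) (z : 'rV[int]_d) :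
    set 'rV[R]_d :=
  [set x | forall i, (z ord0 i)%:~R <= x ord0 i < (z ord0 i)%:~R + 1].

Definition closed_box (R : realType) (d : nat) (s : R) : set 'rV[R]_d :=
  [set x | forall i, 0 <= x ord0 i <= s].

(* Points of P outside [0, #|P|^(1/d)]^d are not excluded. *)
Definition well_distributed (R : realType) (d : nat) (c : R)
    (P : {fset 'rV[R]_d}) : Prop :=
  (forall p p' : 'rV[R]_d, p \in P -> p' \in P -> p != p' ->
     c <= euclidean_norm (p - p')) /\
  (forall z : 'rV[int]_d,
     (unit_lattice_cube z : set 'rV[R]_d)
       `<=` closed_box ((#|` P|)%:R `^ (d%:R^-1)) ->
     exists! p : 'rV[R]_d, p \in P /\ unit_lattice_cube z p).

(* Main.v *)
Require Import Defs.
From mathcomp Require Import all_boot all_order all_algebra.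
From mathcomp Require Import finmap.
From mathcomp Require Import complex.
From mathcomp Require Import all_classical all_reals all_analysis.
From mathcomp Require Import zify ring lra.
Import Order.TTheory GRing.Theory Num.Theory.
Import numFieldNormedType.Exports ComplexField.Normc.
Set Implicit Arguments.
Unset Strict Implicit.
Unset Printing Implicit Defensive.
Local Open Scope ring_scope.

Local Arguments conjc {R} x : simpl never.

(** Let s = n^(1/d), D = d - 1, del = n^(-(d-1)/(d(d+1))) and K about 1/del, so that
    K^(D+2) is of order s^D. A random pair has its distance within del of an integer with
    probability of order 1/K; the claim is that a well-distributed set does not exceed
    the resulting count n^2/K by more than a constant factor.

    Two kinds of pairs are few for trivial reasons. The points outside [0,s]^d number
    O(s^D) ([card_outside_box_le]) and belong to O(n^2/s) pairs. The pairs at distance at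
    most a small power of 1/K times s are O(n^2/K) because the points are separated
    ([close_pairs_count]).

    For the other pairs the distance is made bilinear. Cover the directions by O(Q^D) caps
    of radius 1/Q, where Q = (K s)^(1/4), and rotate the centre of a cap to the first axis
    ([exists_frame], [exists_net_vector]). Cut space into thin slabs orthogonal to this axis,
    and two slabs at distance about h into boxes of side about h/Q. For p and p' in two such
    boxes the distance r satisfies (r - h)^2 / h = O(1/K), so that r - h may be replaced by
    (r^2 - h^2) / (2h) at the cost of a constant factor in the tolerance
    ([near_int_phase_le]). Now r^2 is a polynomial: what must be almost integral is
    al(p) + be(p') - x.x'/h, where x and x' are the transversal coordinates in R^D
    ([cell_pair_count]).

    It remains to count almost integral values of a bilinear form with arbitrary labels al
    and be, for points lying one per unit cell in two boxes of side m ([bilinear_count]). The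
    Fejer kernel turns this into exponential sums of frequency k < K. By Cauchy-Schwarz and
    orthogonality over a lattice whose spacing is adapted to k ([bilinear_sum_le]), the sum of
    frequency k is at most a constant times m^(2D) (k/h + h/(k m^2))^(D/2). For m about h/Q the
    sum over k is O(m^(2D)) up to the factor (s/h)^(D/2), precisely because K^(D+2) is of order
    s^D ([slab_pair_total_le]). Adding up the boxes, slabs and caps gives O(n^2/K)
    ([axis_pairs_count], [far_pairs_count]). *)

(** * Exponentials and geometric sums *)

Section ExponentialSums.
Variable R : realType.
Implicit Types (t x y : R).

Lemma abs_sin_le x : `|sin x| <= `|x|.
Proof.
wlog x0 : x / 0 < x.
  move=> H; case: (ltgtP 0 x) => [|x0|<-]; first exact: H.
    by rewrite -normrN -sinN -(normrN x) H// oppr_gt0.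
  by rewrite sin0 normr0.
have [c _ E] : exists2 c, c \in `]0, x[%R & sin x - sin 0 = cos c * (x - 0).
  apply: MVT => //; apply: continuous_subspaceT => z; exact: continuous_sin.
move: E; rewrite sin0 !subr0 => ->; rewrite normrM.
by rewrite ler_piMl// cos_max.
Qed.

Lemma cos_ge_parabola x : 1 - x ^+ 2 / 2 <= cos x.
Proof.
have -> : cos x = 1 - 2 * sin (x / 2) ^+ 2.
  have -> : cos x = cos (x / 2 + x / 2) by congr cos; field.
  by rewrite cosD -!expr2 sin2cos2; ring.
have := abs_sin_le (x / 2); rewrite -(@ler_pXn2r _ 2)// ?nnegrE//.
by rewrite !real_normK ?num_real// exprMn => h; nra.
Qed.

Lemma cos_ge_half x : `|x| <= 1 -> 2^-1 <= cos x.
Proof.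
move=> x1; apply: le_trans (cos_ge_parabola x).
have : `|x| ^+ 2 <= 1 by rewrite expr_le1.
by rewrite real_normK ?num_real//; lra.
Qed.

Lemma abs_sin_ge x : `|x| <= 1 -> `|x| / 2 <= `|sin x|.
Proof.
wlog x0 : x / 0 < x.
  move=> H; case: (ltgtP 0 x) => [|x0|<-]; first exact: H.
    by move=> x1; rewrite -(normrN (sin x)) -sinN -(normrN x) H ?oppr_gt0 ?normrN.
  by rewrite sin0 normr0 mul0r.
move=> x1.
have [c cx E] : exists2 c, c \in `]0, x[%R & sin x - sin 0 = cos c * (x - 0).
  apply: MVT => //; apply: continuous_subspaceT => z; exact: continuous_sin.
move: E; rewrite sin0 !subr0 => ->; rewrite normrM mulrC ler_wpM2r//.
apply: le_trans (ler_norm _); apply: cos_ge_half.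
move: cx; rewrite in_itv /= => /andP[c0 cx].
by rewrite gtr0_norm// (le_trans (ltW cx))// -(gtr0_norm x0).
Qed.

Definition expi t : R[i] := (cos t +i* sin t)%C.

Lemma normc_ge0 (z : R[i]) : 0 <= normc z.
Proof. by case: z => a b; exact: sqrtr_ge0. Qed.
Lemma normc_real (x : R) : normc (x%:C)%C = `|x|.
Proof. by rewrite /normc /= expr0n addr0 sqrtr_sqr. Qed.
Lemma normc_conj (z : R[i]) : normc (z^*)%C = normc z.
Proof. by case: z => a b; rewrite /normc /= sqrrN. Qed.
Lemma normc_sum (I : Type) (r : seq I) (P : pred I) (F : I -> R[i]) :
  normc (\sum_(i <- r | P i) F i) <= \sum_(i <- r | P i) normc (F i).
Proof.
elim/big_rec2 : _ => [|i y x _ h]; first by rewrite normc0.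
by apply: le_trans (le_normcD _ _) _; rewrite lerD2l.
Qed.
Lemma normc_prod (I : Type) (r : seq I) (P : pred I) (F : I -> R[i]) :
  normc (\prod_(i <- r | P i) F i) = \prod_(i <- r | P i) normc (F i).
Proof.
by elim/big_rec2 : _ => [|i y x _ h]; rewrite ?normc1 // normcM h.
Qed.
Lemma normc_sqr (z : R[i]) : ((normc z ^+ 2)%:C)%C = z * (z^*)%C.
Proof.
case: z => a b; rewrite /normc /= sqr_sqrtr ?addr_ge0 ?sqr_ge0//.
by simpc; rewrite [b * a]mulrC addNr !expr2.
Qed.
Lemma Re_le_normc (z : R[i]) : complex.Re z <= normc z.
Proof.
case: z => a b; rewrite /normc /=; apply: le_trans (ler_norm _) _.
by rewrite -sqrtr_sqr ler_wsqrtr// lerDl sqr_ge0.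
Qed.
Lemma Re_sum (I : Type) (r : seq I) (P : pred I) (F : I -> R[i]) :
  complex.Re (\sum_(i <- r | P i) F i) = \sum_(i <- r | P i) complex.Re (F i).
Proof. by elim/big_rec2 : _ => [|i y x _ <-] //; case: (F i) => a b; case: x. Qed.
Lemma Im_le_normc (z : R[i]) : `|complex.Im z| <= normc z.
Proof.
by case: z => a b; rewrite /normc /= -sqrtr_sqr ler_wsqrtr// lerDr sqr_ge0.
Qed.

Lemma expiD x y : expi (x + y) = expi x * expi y.
Proof.
rewrite /expi cosD sinD; apply/eqP; rewrite eq_complex /= eqxx /=.
by apply/eqP; ring.
Qed.
Lemma expi0 : expi 0 = 1.
Proof. by rewrite /expi cos0 sin0. Qed.
Lemma expi_sum (I : Type) (r : seq I) (P : pred I) (F : I -> R) :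
  expi (\sum_(i <- r | P i) F i) = \prod_(i <- r | P i) expi (F i).
Proof. by elim/big_rec2 : _ => [|i y x _ <-]; rewrite ?expi0 ?expiD. Qed.
Lemma expi_conj x : (expi x)^*%C = expi (- x).
Proof. by rewrite /expi cosN sinN. Qed.
Lemma normc_expi x : normc (expi x) = 1.
Proof. by rewrite /normc /= cos2Dsin2 sqrtr1. Qed.
Lemma expi_nat n x : expi (n%:R * x) = expi x ^+ n.
Proof.
elim: n => [|n IH]; first by rewrite mul0r expi0.
by rewrite -addn1 natrD mulrDl mul1r expiD IH addn1 exprSr.
Qed.
Lemma expi_2pi_nat n : expi (2 * pi * n%:R) = 1.
Proof.
rewrite mulrC expi_nat; have -> : expi (2 * pi) = 1.
  by rewrite /expi mulr_natl cos2pi sin2pi.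
by rewrite expr1n.
Qed.
Lemma expi_2pi_int (z : int) : expi (2 * pi * z%:~R) = 1.
Proof.
case: z => n; first exact: expi_2pi_nat.
rewrite NegzE mulrNz mulrN -expi_conj -[(n.+1)%:~R]/((n.+1)%:R) expi_2pi_nat.
exact: conjc1.
Qed.

Lemma normc_expi_sub1 t : `|t| <= 1 -> `|t| / 2 <= normc (expi t - 1).
Proof.
move=> t1; apply: le_trans (Im_le_normc _).
by rewrite /= subr0 abs_sin_ge.
Qed.

Definition geosum n t : R[i] := \sum_(j < n) expi (j%:R * t).

Lemma geosum_le_nat n t : normc (geosum n t) <= n%:R.
Proof.
rewrite /geosum; apply: le_trans (normc_sum _ _ _) _.
under eq_bigr do rewrite normc_expi.
by rewrite big_const_ord iter_addr_0 -mulr_natr mul1r.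
Qed.

Lemma geosum_le_inv n t : t != 0 -> `|t| <= 1 -> normc (geosum n t) <= 4 / `|t|.
Proof.
move=> t0 t1; have tp : 0 < `|t| by rewrite normr_gt0.
have E : (expi t - 1) * geosum n t = expi (n%:R * t) - 1.
  rewrite expi_nat subrX1; congr (_ * _); apply: eq_bigr => i _.
  by rewrite expi_nat.
have h1 : `|t| / 2 * normc (geosum n t) <= 2.
  apply: (@le_trans _ _ (normc (expi t - 1) * normc (geosum n t))).
    by rewrite ler_wpM2r ?normc_ge0 ?normc_expi_sub1.
  rewrite -normcM E; apply: le_trans (le_normcD _ _) _.
  by rewrite normcN normc1 normc_expi; lra.
by rewrite ler_pdivlMr//; lra.
Qed.

(** Both bounds for the geometric sum in one expression: its square is summable over
    well spaced t, by the telescoping in [sum_inv_sqr_le]. *)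
Lemma geosum_le n (G t : R) : 0 < G -> n%:R <= 2 * G -> `|t| <= 1 ->
  normc (geosum n t) <= 4 * G / (1 + G * `|t| / 2).
Proof.
move=> G0 nG t1.
have t0 : 0 <= `|t| by [].
have p : 0 < 1 + G * `|t| / 2 by have := mulr_ge0 (ltW G0) t0; lra.
rewrite ler_pdivlMr//.
have [h|h] := leP (G * `|t|) 2.
  apply: (@le_trans _ _ (2 * G * (1 + G * `|t| / 2))).
    by rewrite ler_wpM2r ?(ltW p)// (le_trans (geosum_le_nat _ _)).
  nra.
have tn0 : t != 0 by apply: contraTneq h => ->; rewrite normr0 mulr0 -leNgt.
have tp : 0 < `|t| by rewrite normr_gt0.
have := geosum_le_inv n tn0 t1; rewrite ler_pdivlMr// => h2.
have := normc_ge0 (geosum n t); nra.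
Qed.

(** All the terms lie in the half plane where the real part is at least 1/2. *)
Lemma geosum_ge n t : n%:R * `|t| <= 1 -> n%:R / 2 <= normc (geosum n t).
Proof.
move=> nt; apply: le_trans (Re_le_normc _).
rewrite /geosum Re_sum.
apply: (@le_trans _ _ (\sum_(j < n) 2^-1)).
  by rewrite big_const_ord iter_addr_0 -[leRHS]mulr_natl.
apply: ler_sum => j _; apply: cos_ge_half.
rewrite normrM normr_nat; apply: le_trans nt.
by rewrite ler_wpM2r// ler_nat ltnW.
Qed.

End ExponentialSums.

(** * Elementary sums and mean squares over grids *)

Section FiniteSums.
Variable R : realType.

Lemma sum_sqr_le (I : finType) (F : I -> R) :
  (\sum_i F i) ^+ 2 <= #|I|%:R * \sum_i F i ^+ 2.
Proof.
have H : 0 <= \sum_i \sum_j (F i - F j) ^+ 2.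
  by apply: sumr_ge0 => i _; apply: sumr_ge0 => j _; exact: sqr_ge0.
have E : \sum_i \sum_j (F i - F j) ^+ 2 =
    2 * (#|I|%:R * \sum_i F i ^+ 2 - (\sum_i F i) ^+ 2).
  set S := \sum_i F i; set Q := \sum_i F i ^+ 2.
  rewrite (eq_bigr (fun i => (#|I|%:R * F i ^+ 2 - 2 * S * F i) + Q)) => [|i _].
    rewrite big_split /= sumrB -!mulr_sumr sumr_const -[Q *+ _]mulr_natl -/S -/Q.
    by rewrite cardT -cardE; ring.
  transitivity (\sum_(j : I) F i ^+ 2 - 2 * F i * S + Q); last first.
    by rewrite sumr_const cardT -cardE -[_ *+ _]mulr_natl; ring.
  rewrite /S /Q mulr_sumr -sumrB -big_split /=; apply: eq_bigr => j _; ring.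
by rewrite E in H; lra.
Qed.

Lemma sum_fibre_le (I J : finType) (f : I -> J) (B : nat) (H : J -> R) :
  (forall j, 0 <= H j) -> (forall j, (#|[set i | f i == j]| <= B)%N) ->
  \sum_i H (f i) <= B%:R * \sum_j H j.
Proof.
move=> H0 fB; rewrite (partition_big f xpredT)//= mulr_sumr.
apply: ler_sum => j _; rewrite (eq_bigr (fun=> H j)) => [|i /eqP->//].
rewrite sumr_const -[H j *+ _]mulr_natl ler_wpM2r//.
by rewrite ler_nat; apply: leq_trans (fB j); rewrite cardsE.
Qed.

(** Telescoping: u / ((1 + u s) (1 + u (s + 1))) is the difference of two consecutive
    values of 1 / (1 + u s). *)
Lemma sum_inv_sqr_le (u : R) n : 0 < u ->
  \sum_(0 <= s < n) (1 + u * s.+1%:R)^-2 <= u^-1.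
Proof.
move=> u0.
have p s : 0 < 1 + u * s%:R by rewrite ltr_wpDr// mulr_ge0// ltW.
have H : \sum_(0 <= s < n) (1 + u * s.+1%:R)^-2
    <= \sum_(0 <= s < n) (- u^-1 * (1 + u * s.+1%:R)^-1 - (- u^-1 * (1 + u * s%:R)^-1)).
  apply: ler_sum => s _; rewrite -subr_ge0.
  set x := 1 + u * s.+1%:R; set y := 1 + u * s%:R.
  have E : x = y + u by rewrite /x /y -natr1; ring.
  have yp : 0 < y by exact: p.
  have -> : - u^-1 * x^-1 - - u^-1 * y^-1 - x ^- 2 = u / (y * x ^+ 2).
    by rewrite E; field; lra.
  by apply: divr_ge0; [exact: ltW | apply: mulr_ge0; [exact: ltW | exact: sqr_ge0]].
apply: le_trans H _; rewrite telescope_sumr// mulr0 addr0 invr1.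
have : 0 <= u^-1 * (1 + u * n%:R)^-1 by rewrite mulr_ge0 ?invr_ge0 ?ltW.
by lra.
Qed.

Lemma sum_dist_le (F : nat -> R) (m a : nat) : (forall s, 0 <= F s) ->
  (a < m)%N ->
  \sum_(b < m) F ((a - b) + (b - a))%N <= 2 * \sum_(0 <= s < m) F s.
Proof.
move=> F0 am.
have mon n : (n <= m)%N -> \sum_(0 <= s < n) F s <= \sum_(0 <= s < m) F s.
  by move=> nm; rewrite [leRHS](big_cat_nat (n := n))//= lerDl sumr_ge0.
rewrite -(big_mkord xpredT (fun b => F ((a - b) + (b - a))%N)).
rewrite (big_cat_nat (n := a.+1))//= mulr_natl mulr2n.
apply: lerD.
- rewrite big_nat_rev /= add0n.
  rewrite (eq_big_nat _ _ (F2 := F)) ?mon// => i /andP[_ ia]; congr F; lia.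
- rewrite -{1}[a.+1]add0n big_addn.
  rewrite (eq_big_nat _ _ (F2 := fun i => F i.+1)); last first.
    by move=> i _; congr F; lia.
  have h : ((m - a.+1).+1 <= m)%N by lia.
  by have := mon _ h; rewrite big_nat_recl//; apply: le_trans; rewrite lerDr.
Qed.

Lemma sum_inv_sqr_dist_le (u : R) (m a : nat) : 0 < u -> (a < m)%N ->
  \sum_(b < m) (1 + u * ((a - b) + (b - a)).-1%:R)^-2 <= 4 + 2 / u.
Proof.
move=> u0 am; pose F s := (1 + u * s.-1%:R)^-2.
have F0 s : 0 <= F s by rewrite invr_ge0 sqr_ge0.
have HF n : \sum_(0 <= s < n) F s <= 2 + u^-1.
  case: n => [|[|n]].
  - by rewrite big_geq// addr_ge0// invr_ge0 ltW.
  - rewrite big_nat1 /F mulr0 addr0 expr1n invr1.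
    by have := ltW u0; rewrite -invr_ge0; lra.
  - rewrite big_nat_recl// big_nat_recl// /F /= mulr0 addr0 expr1n invr1.
    by have := sum_inv_sqr_le n u0; lra.
have -> : 4 + 2 / u = 2 * (2 + u^-1) by ring.
by apply: le_trans (sum_dist_le F0 am) _; rewrite ler_pM2l.
Qed.

(** Expand the square: for each pair q, q' the exponential is a product over the
    coordinates, so that its sum over the grid factors into geometric sums. The grid
    consists of differences j - j' in order that each coordinate contributes two
    geometric sums: a single one decays like 1/|t| only, and its sum over separated t
    would cost a logarithm. *)
Lemma sum_sqr_grid_le (D n1 n2 : nat) (J : finType) (kap : R)
    (b : J -> R[i]) (y : J -> 'I_D -> R) :
  \sum_(j : {ffun 'I_D -> 'I_n1}) \sum_(j' : {ffun 'I_D -> 'I_n2})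
     normc (\sum_q b q * expi (kap * \sum_k ((j k)%:R - (j' k)%:R) * y q k)) ^+ 2
  <= \sum_q \sum_q' normc (b q) * normc (b q') *
      \prod_k (normc (geosum n1 (kap * (y q k - y q' k))) *
               normc (geosum n2 (- (kap * (y q k - y q' k))))).
Proof.
set LHS := (X in X <= _).
have L0 : 0 <= LHS by apply: sumr_ge0 => j _; apply: sumr_ge0 => j' _; exact: sqr_ge0.
rewrite -(ger0_norm L0) -normc_real.
have -> : (LHS%:C)%C = \sum_q \sum_q' b q * (b q')^*%C *
    \prod_k (geosum n1 (kap * (y q k - y q' k)) *
             geosum n2 (- (kap * (y q k - y q' k)))).
  pose T (j : {ffun 'I_D -> 'I_n1}) (j' : {ffun 'I_D -> 'I_n2}) q q' := b q * (b q')^*%C *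
    expi (\sum_k ((j k)%:R * (kap * (y q k - y q' k)))
        + \sum_k ((j' k)%:R * - (kap * (y q k - y q' k)))).
  transitivity (\sum_(j : {ffun 'I_D -> 'I_n1}) \sum_(j' : {ffun 'I_D -> 'I_n2})
                 \sum_q \sum_q' T j j' q q').
    rewrite /LHS rmorph_sum /=; apply: eq_bigr => j _.
    rewrite rmorph_sum /=; apply: eq_bigr => j' _.
    rewrite normc_sqr rmorph_sum /= mulr_suml; apply: eq_bigr => q _.
    rewrite mulr_sumr; apply: eq_bigr => q' _.
    rewrite rmorphM /= expi_conj mulrACA -expiD /T; congr (_ * expi _).
    rewrite !mulr_sumr -sumrN -!big_split /=; apply: eq_bigr => k _; ring.
  rewrite (eq_bigr (fun j => \sum_q \sum_q' \sum_j' T j j' q q')) => [|j _]; last first.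
    rewrite exchange_big /=; apply: eq_bigr => q _; exact: exchange_big.
  rewrite exchange_big /=; apply: eq_bigr => q _.
  rewrite exchange_big /=; apply: eq_bigr => q' _.
  rewrite big_split /= /geosum !bigA_distr_bigA /= mulr_suml mulr_sumr.
  apply: eq_bigr => j _; rewrite !mulr_sumr; apply: eq_bigr => j' _.
  by rewrite -!expi_sum -expiD.
apply: le_trans (normc_sum _ _ _) _; apply: ler_sum => q _.
apply: le_trans (normc_sum _ _ _) _; apply: ler_sum => q' _.
rewrite !normcM normc_conj normc_prod le_eqVlt; apply/orP; left; apply/eqP.
by congr (_ * _); apply: eq_bigr => k _; rewrite normcM.
Qed.

End FiniteSums.

(** * Bilinear exponential sums over separated points *)

Section BilinearSums.
Variable R : realType.

Lemma geosum_pair_le (n1 n2 : nat) (G t : R) : 0 < G ->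
  n1%:R <= 2 * G -> n2%:R <= 2 * G -> `|t| <= 1 ->
  normc (geosum n1 t) * normc (geosum n2 (- t))
    <= 16 * G ^+ 2 * (1 + G * `|t| / 2) ^- 2.
Proof.
move=> G0 h1 h2 t1; have H1 := geosum_le G0 h1 t1.
have H2 : normc (geosum n2 (- t)) <= 4 * G / (1 + G * `|t| / 2).
  by rewrite -(normrN t); apply: geosum_le => //; rewrite normrN.
apply: le_trans (ler_pM (normc_ge0 _) (normc_ge0 _) H1 H2) _.
by rewrite mulrACA -invfM -!expr2 exprMn -natrX.
Qed.

Lemma dist_cells_le (a b : nat) (x y : R) :
  a%:R <= x < a%:R + 1 -> b%:R <= y < b%:R + 1 ->
  ((a - b) + (b - a)).-1%:R <= `|x - y|.
Proof.
move=> /andP[ax xa] /andP[b_y yb].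
have [ab|ab|->] := ltngtP a b.
- have -> : ((a - b) + (b - a)).-1 = (b - a.+1)%N by lia.
  rewrite natrB// -natr1 ler_normr; apply/orP; right; lra.
- have -> : ((a - b) + (b - a)).-1 = (a - b.+1)%N by lia.
  rewrite natrB// -natr1 ler_normr; apply/orP; left; lra.
- by rewrite subnn.
Qed.

(** A form of the double large sieve. The points g p / L0 and y q lie one per unit cell
    in [0,m)^D. By Cauchy-Schwarz over p it suffices to bound the mean square of the sum
    over q on the lattice of the g p, which [sum_sqr_grid_le] reduces to geometric sums in
    y q - y q'. These are summable over q' because the y q are separated.

    Summing over the whole lattice is wasteful at low frequency: only m^D of its
    (m L0)^D points are of the form g p, while the sum over q hardly varies from one
    lattice point to the next. Hence each g p is first replaced by its L^D translates
    by less than L steps, which gains L^D. The translates change the sum over q only by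
    a factor that depends on q alone and can be absorbed in b q. *)
Lemma bilinear_sum_le (D m L0 L : nat) (I J : finType)
    (ci : I -> {ffun 'I_D -> 'I_m}) (cj : J -> {ffun 'I_D -> 'I_m})
    (g : I -> 'I_D -> nat) (y : J -> 'I_D -> R)
    (a : I -> R[i]) (b : J -> R[i]) (kap G : R) :
  injective ci -> injective cj -> (0 < m)%N -> (0 < L)%N -> (L <= L0)%N ->
  (forall p k, (ci p k * L0 <= g p k < (ci p k).+1 * L0)%N) ->
  (forall q k, (cj q k)%:R <= y q k < (cj q k)%:R + 1) ->
  (forall p, normc (a p) <= 1) -> (forall q, normc (b q) <= 1) ->
  kap != 0 -> L%:R * (m%:R * `|kap|) <= 1 ->
  G = 2 * m%:R * L0%:R ->
  normc (\sum_p \sum_q a p * b q * expi (kap * \sum_k (g p k)%:R * y q k)) ^+ 2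
    <= (2 ^+ 9 * m%:R ^+ 2 * (G / L%:R) * (1 + (G * `|kap|)^-1)) ^+ D.
Proof.
move=> ciI cjI m0 L0' LL0 gP yP a1 b1 k0 kL Gdef.
pose Gn := (2 * m * L0)%N.
have GE : G = Gn%:R by rewrite Gdef /Gn !natrM.
have Gn0 : (0 < Gn)%N by rewrite /Gn !muln_gt0 m0 (leq_trans L0' LL0).
have Gp : 0 < G by rewrite GE ltr0n.
have Lp : 0 < L%:R :> R by rewrite ltr0n.
have kp : 0 < `|kap| by rewrite normr_gt0.
have ym q k : `|y q k| <= m%:R.
  have /andP[h1 h2] := yP q k; rewrite ger0_norm; last by apply: le_trans h1.
  apply: le_trans (ltW h2) _; rewrite natr1 ler_nat; exact: ltn_ord.
(* Translating g p by u multiplies the q-th exponential by a factor whose sum over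
   u is avg q; it is of order L^D because the phases kap u y are at most 1. *)
pose avg q := \prod_k geosum L (kap * y q k).
have avg_ge q : (L%:R / 2) ^+ D <= normc (avg q).
  rewrite /avg normc_prod -[D in _ ^+ D]card_ord -prodr_const.
  apply: ler_prod => k _; rewrite divr_ge0//=.
  apply: geosum_ge; apply: le_trans kL; rewrite ler_pM2l//.
  by rewrite normrM mulrC ler_wpM2r.
have L2p : 0 < (L%:R / 2 : R) ^+ D by rewrite exprn_gt0// divr_gt0.
have avg0 q : avg q != 0.
  apply/eqP => h; have := lt_le_trans L2p (avg_ge q).
  by rewrite h normc0 ltxx.
pose b' q := b q / avg q.
have b'1 q : normc (b' q) <= (2 / L%:R) ^+ D.
  rewrite /b' normcM normcV -[leRHS]mul1r ler_pM ?normc_ge0 ?invr_ge0 ?normc_ge0//.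
  rewrite -[2 / _]invf_div exprVn lef_pV2 ?avg_ge// posrE//.
  exact: lt_le_trans (avg_ge q).
pose F (v : 'I_D -> R) := \sum_q b' q * expi (kap * \sum_k v k * y q k).
pose pu := (I * {ffun 'I_D -> 'I_L})%type.
pose w (z : pu) k : nat := (g z.1 k + z.2 k)%N.
have S1 : \sum_p \sum_q a p * b q * expi (kap * \sum_k (g p k)%:R * y q k)
    = \sum_(z : pu) a z.1 * F (fun k => (w z k)%:R).
  rewrite -(pair_bigA _ (fun p (u : {ffun 'I_D -> 'I_L}) => a p * F (fun k => (g p k + u k)%:R))) /=.
  apply: eq_bigr => p _; rewrite -mulr_sumr /F exchange_big mulr_sumr /=.
  apply: eq_bigr => q _; rewrite -mulrA; congr (_ * _).
  transitivity (b' q * (expi (kap * \sum_k (g p k)%:R * y q k) * avg q)).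
    by rewrite /b' mulrA [in RHS]mulrAC divfK.
  rewrite -mulr_sumr; congr (_ * _); rewrite /avg /geosum bigA_distr_bigA /= mulr_sumr.
  apply: eq_bigr => u _; rewrite -expi_sum -expiD; congr expi.
  rewrite !mulr_sumr -big_split /=; apply: eq_bigr => k _; rewrite natrD; ring.
have S2 : normc (\sum_p \sum_q a p * b q * expi (kap * \sum_k (g p k)%:R * y q k)) ^+ 2
    <= (m%:R * L%:R) ^+ D * \sum_(z : pu) normc (F (fun k => (w z k)%:R)) ^+ 2.
  rewrite S1.
  apply: (@le_trans _ _ ((\sum_(z : pu) normc (F (fun k => (w z k)%:R))) ^+ 2)).
    rewrite ler_pXn2r ?nnegrE ?normc_ge0//; last by apply: sumr_ge0 => z _; exact: normc_ge0.
    apply: le_trans (normc_sum _ _ _) _; apply: ler_sum => z _.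
    by rewrite normcM ler_piMl ?normc_ge0.
  apply: le_trans (sum_sqr_le _) _; apply: ler_wpM2r.
    by apply: sumr_ge0 => z _; exact: sqr_ge0.
  rewrite card_prod card_ffun !card_ord natrM natrX exprMn ler_wpM2r ?exprn_ge0//.
  by rewrite -natrX ler_nat; have := leq_card ci ciI; rewrite card_ffun !card_ord.
have wG z (j' : {ffun 'I_D -> 'I_Gn}) k : (w z k + j' k < 2 * Gn)%N.
  have /andP[_ h1] := gP z.1 k; have h2 := ltn_ord (z.2 k); have h3 := ltn_ord (j' k).
  have h4 : ((ci z.1 k).+1 * L0 <= m * L0)%N by rewrite leq_mul2r ltn_ord orbT.
  have h5 : (L0 <= m * L0)%N by rewrite leq_pmull.
  have h6 : Gn = (m * L0 + m * L0)%N by rewrite /Gn -mulnA mul2n addnn.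
  by move: h3; rewrite /w => h3; lia.
pose Phi (j' : {ffun 'I_D -> 'I_Gn}) (z : pu) : {ffun 'I_D -> 'I_(2 * Gn)} :=
  [ffun k => Ordinal (wG z j' k)].
(* A lattice point has at most 2^D representations: in each coordinate the
   cell of p is the one that contains w, or the one before, since L <= L0. *)
have fib j' (j : {ffun 'I_D -> 'I_(2 * Gn)}) : (#|[set z | Phi j' z == j]| <= 2 ^ D)%N.
  pose eps (z : pu) : {ffun 'I_D -> bool} := [ffun k => (w z k %/ L0 == ci z.1 k)%N].
  have -> : (2 ^ D)%N = #|{ffun 'I_D -> bool}| by rewrite card_ffun card_bool card_ord.
  apply: (@leq_card_in _ _ eps) => // z1 z2; rewrite !inE => /eqP h1 /eqP h2 h3.
  have wE k : w z1 k = w z2 k.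
    have := congr1 val (congr1 (fun f : {ffun _} => f k) (etrans h1 (esym h2))).
    by rewrite !ffunE /= => /addIn.
  have wq z k : (w z k %/ L0 = ci z.1 k \/ w z k %/ L0 = (ci z.1 k).+1)%N.
    have /andP[e1 e2] := gP z.1 k; have e3 := ltn_ord (z.2 k).
    have L0p : (0 < L0)%N by apply: leq_trans L0' LL0.
    have [e4|e4] := ltnP (w z k) ((ci z.1 k).+1 * L0).
      left; apply/eqP; rewrite eqn_leq leq_divRL// -ltnS ltn_divLR// e4 /=.
      by rewrite (leq_trans e1)// leq_addr.
    right; apply/eqP; rewrite eqn_leq leq_divRL// -ltnS ltn_divLR// e4 andbT.
    by rewrite /w !mulSn in e2 *; lia.
  have cE : ci z1.1 = ci z2.1.
    apply/ffunP => k; apply: val_inj => /=.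
    have := congr1 (fun f : {ffun _} => f k) h3; rewrite !ffunE wE.
    have := wq z1 k; have := wq z2 k; rewrite wE.
    by move=> [] -> [] h //; rewrite ?h ?eqxx; move: h => /= h; lia.
  have pE : z1.1 = z2.1 by apply: ciI.
  have uE : z1.2 = z2.2.
    apply/ffunP => k; apply: val_inj; have := wE k; rewrite /w pE; exact: addnI.
  by case: (z1) (z2) pE uE => [? ?] [? ?] /= -> ->.
have S3 : G ^+ D * (\sum_(z : pu) normc (F (fun k => (w z k)%:R)) ^+ 2) <=
   2 ^+ D * \sum_(j : {ffun 'I_D -> 'I_(2 * Gn)}) \sum_(j' : {ffun 'I_D -> 'I_Gn})
     normc (F (fun k => (j k)%:R - (j' k)%:R)) ^+ 2.
  rewrite exchange_big /=.
  apply: (@le_trans _ _ (\sum_(j' : {ffun 'I_D -> 'I_Gn})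
     2 ^+ D * \sum_(j : {ffun 'I_D -> 'I_(2 * Gn)})
        normc (F (fun k => (j k)%:R - (j' k)%:R)) ^+ 2)); last by rewrite mulr_sumr.
  have -> : G ^+ D = (#|{ffun 'I_D -> 'I_Gn}|)%:R by rewrite card_ffun !card_ord GE natrX.
  rewrite mulr_natl -sumr_const; apply: ler_sum => j' _.
  rewrite -natrX; apply: le_trans (sum_fibre_le _ (fib j')); last by move=> j; exact: sqr_ge0.
  rewrite le_eqVlt; apply/orP; left; apply/eqP; apply: eq_bigr => z _.
  congr (normc (F _) ^+ 2); apply/funext => k.
  by rewrite ffunE /= natrD addrK.
have S4 : \sum_(j : {ffun 'I_D -> 'I_(2 * Gn)}) \sum_(j' : {ffun 'I_D -> 'I_Gn})
     normc (F (fun k => (j k)%:R - (j' k)%:R)) ^+ 2 <=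
   (m%:R * (2 / L%:R) ^+ 2 * (16 * G ^+ 2 * (4 + 4 / (G * `|kap|)))) ^+ D.
  rewrite /F; apply: le_trans (@sum_sqr_grid_le _ _ (2 * Gn) Gn _ kap b' y) _.
  pose W (s t : 'I_m) : R := 16 * G ^+ 2 *
     (1 + (G * `|kap| / 2) * ((s - t) + (t - s)).-1%:R) ^- 2.
  have W0 s t : 0 <= W s t.
    apply: mulr_ge0; first exact: mulr_ge0 (sqr_ge0 _).
    by rewrite invr_ge0 sqr_ge0.
  have WS s : \sum_t W s t <= 16 * G ^+ 2 * (4 + 4 / (G * `|kap|)).
    rewrite -mulr_sumr ler_wpM2l ?(mulr_ge0 _ (sqr_ge0 _))//.
    apply: le_trans (sum_inv_sqr_dist_le _ (ltn_ord s)) _.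
      by rewrite divr_gt0// mulr_gt0.
    rewrite le_eqVlt; apply/orP; left; apply/eqP; field.
    by rewrite (gt_eqF kp) (gt_eqF Gp).
  apply: (@le_trans _ _ (\sum_q \sum_q' ((2 / L%:R) ^+ D) ^+ 2 *
      \prod_k W (cj q k) (cj q' k))).
    apply: ler_sum => q _; apply: ler_sum => q' _.
    have B0 : 0 <= (2 / L%:R : R) ^+ D by rewrite exprn_ge0// divr_ge0.
    apply: ler_pM; rewrite ?mulr_ge0 ?normc_ge0//.
    - by apply: prodr_ge0 => k _; rewrite mulr_ge0 ?normc_ge0.
    - by rewrite expr2 ler_pM ?normc_ge0.
    apply: ler_prod => k _; rewrite mulr_ge0 ?normc_ge0//=.
    apply: le_trans (geosum_pair_le Gp _ _ _) _.
    - by rewrite GE natrM.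
    - by rewrite GE; lra.
    - rewrite normrM; apply: le_trans kL; rewrite mulrC.
      have yy : `|y q k - y q' k| <= m%:R.
        have /andP[h1 h2] := yP q k; have /andP[h3 h4] := yP q' k.
        have c1 := le_trans (ler0n R _) h1; have c2 := le_trans (ler0n R _) h3.
        have := ym q k; rewrite (ger0_norm c1) => c3.
        have := ym q' k; rewrite (ger0_norm c2) => c4.
        by rewrite ler_norml; apply/andP; split; lra.
      apply: le_trans (_ : m%:R * `|kap| <= _); first by rewrite ler_wpM2r.
      by rewrite ler_peMl ?mulr_ge0// ler1n.
    rewrite /W ler_wpM2l ?(mulr_ge0 _ (sqr_ge0 _))//.
    have D1 := dist_cells_le (yP q k) (yP q' k).
    set n := ((_ - _) + _).-1 in D1 *.
    have c0 : 0 <= G * `|kap| / 2 by rewrite divr_ge0// mulr_ge0 ?ltW.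
    have e0 : 0 <= G * `|kap| / 2 * n%:R by rewrite mulr_ge0.
    have e1 : G * `|kap| / 2 * n%:R <= G * `|kap * (y q k - y q' k)| / 2.
      rewrite normrM; have := ler_wpM2l c0 D1; lra.
    set A := G * `|kap| / 2 * n%:R in e0 e1 *.
    set B := G * `|kap * (y q k - y q' k)| / 2 in e1 *.
    have A1 : 0 < 1 + A by lra.
    have B1 : 0 < 1 + B by lra.
    rewrite lef_pV2 ?posrE ?exprn_gt0// ler_pXn2r ?nnegrE ?(ltW A1) ?(ltW B1)//; lra.
  have sJ : \sum_q \sum_q' ((2 / L%:R) ^+ D) ^+ 2 * \prod_k W (cj q k) (cj q' k)
     <= \sum_(q : J) ((2 / L%:R) ^+ 2 * (16 * G ^+ 2 * (4 + 4 / (G * `|kap|)))) ^+ D.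
    apply: ler_sum => q _; rewrite -mulr_sumr [leRHS]exprMn -exprM -[((2 / _) ^+ 2) ^+ D]exprM [(D * 2)%N]mulnC.
    rewrite ler_wpM2l ?exprn_ge0 ?divr_ge0//.
    apply: (@le_trans _ _ (\sum_(c : {ffun 'I_D -> 'I_m}) \prod_k W (cj q k) (c k))).
      pose H (c : {ffun 'I_D -> 'I_m}) := \prod_k W (cj q k) (c k).
      rewrite -[leRHS]mul1r; apply: (@sum_fibre_le _ _ _ cj 1 H) => [c|c].
        by apply: prodr_ge0 => k _; exact: W0.
      apply/card_le1P => z1 h1 z2; rewrite !inE in h1 *.
      rewrite -(eqP h1); apply/eqP/eqP => [/cjI//|->//].
    rewrite -(bigA_distr_bigA (fun k t => W (cj q k) t)) -[D in _ ^+ D]card_ord -prodr_const /=.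
    apply: ler_prod => k _; rewrite WS andbT; apply: sumr_ge0 => t _; exact: W0.
  apply: le_trans sJ _; rewrite sumr_const -[_ *+ _]mulr_natl -[m%:R * _ * _]mulrA [leRHS]exprMn.
  rewrite ler_wpM2r//.
    apply: exprn_ge0; apply: mulr_ge0; first exact: sqr_ge0.
    apply: mulr_ge0; first exact: mulr_ge0 (sqr_ge0 _).
    by apply: addr_ge0 => //; apply: divr_ge0 => //; apply: mulr_ge0; apply: ltW.
  by rewrite -natrX ler_nat; have := leq_card cj cjI; rewrite card_ffun !card_ord.
apply: le_trans S2 _.
rewrite -(ler_pM2l (exprn_gt0 D Gp)) mulrCA.
apply: le_trans (ler_wpM2l _ S3) _; first by rewrite exprn_ge0// mulr_ge0.
apply: le_trans (ler_wpM2l _ (ler_wpM2l _ S4)) _; rewrite ?exprn_ge0 ?mulr_ge0//.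
rewrite -!exprMn le_eqVlt; apply/orP; left; apply/eqP; congr (_ ^+ D).
by field; rewrite (gt_eqF kp) (gt_eqF Gp) (gt_eqF Lp).
Qed.

End BilinearSums.

(** * Counting almost integers by exponential sums *)

Section NearIntegers.
Variable R : realType.

Definition near_int (t x : R) : Prop := exists z : int, `|x - z%:~R| <= t.

Lemma geosum_shift_int K (x : R) (z : int) :
  geosum K (2 * pi * (x - z%:~R)) = geosum K (2 * pi * x).
Proof.
apply: eq_bigr => j _.
have -> : j%:R * (2 * pi * x) = j%:R * (2 * pi * (x - z%:~R)) + 2 * pi * (j%:Z * z)%:~R.
  by rewrite intrM -[(j%:Z)%:~R]/(j%:R); ring.
by rewrite expiD expi_2pi_int mulr1.
Qed.

Lemma card_le_sum (I : finType) (S : {set I}) (f : I -> R) :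
  (forall z, 0 <= f z) -> (forall z, z \in S -> 1 <= f z) ->
  #|S|%:R <= \sum_z f z.
Proof.
move=> f0 f1; rewrite -sum1_card natr_sum [leRHS](bigID (mem S)) /=.
rewrite -[leLHS]addr0 lerD ?sumr_ge0//; exact: ler_sum.
Qed.

(** The Fejer kernel: if th z is within 1/(8K) of an integer then the K phases
    2 pi j th z, j < K, are within 1 of multiples of 2 pi, and their exponentials do not
    cancel. *)
Lemma card_near_int_le (I : finType) (th : I -> R) (K : nat) : (0 < K)%N ->
  #|[set z | `[< near_int (8 * K%:R)^-1 (th z) >]]|%:R
    <= 4 / K%:R ^+ 2 * \sum_z normc (geosum K (2 * pi * th z)) ^+ 2.
Proof.
move=> K0; have Kp : 0 < K%:R :> R by rewrite ltr0n.
rewrite mulr_sumr; apply: card_le_sum => z.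
  by apply: mulr_ge0 (sqr_ge0 _); apply: divr_ge0 => //; exact: sqr_ge0.
rewrite inE => /asboolP[w hw].
have h : K%:R / 2 <= normc (geosum K (2 * pi * th z)).
  rewrite -(geosum_shift_int _ _ w); apply: geosum_ge.
  rewrite normrM [ `|2 * pi|]ger0_norm ?mulr_ge0 ?pi_ge0//.
  apply: (@le_trans _ _ (K%:R * (2 * 4 * (8 * K%:R)^-1))).
    rewrite ler_pM2l//; apply: ler_pM => //; first by rewrite mulr_ge0 ?pi_ge0.
    by rewrite ler_pM2l//; have := pihalf_lt2 R; lra.
  by rewrite le_eqVlt; apply/orP; left; apply/eqP; field; rewrite gt_eqF.
have h2 : (K%:R / 2) ^+ 2 <= normc (geosum K (2 * pi * th z)) ^+ 2.
  by rewrite ler_pXn2r ?nnegrE ?normc_ge0 ?divr_ge0.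
rewrite mulrAC ler_pdivlMr ?exprn_gt0// mul1r.
by move: h2; rewrite expr_div_n; lra.
Qed.

(** Expanding the square leaves the frequencies j - j', each of which occurs at most
    2K times up to sign; opposite frequencies have conjugate sums. *)
Lemma sum_sqr_geosum_le (I : finType) (ph : I -> R) (K : nat) (B : nat -> R) :
  (forall s, 0 <= B s) ->
  (forall s, (s < K)%N -> normc (\sum_z expi (s%:R * ph z)) <= B s) ->
  \sum_z normc (geosum K (ph z)) ^+ 2 <= 2 * K%:R * \sum_(0 <= s < K) B s.
Proof.
move=> B0 BP; set LHS := (X in X <= _).
have L0 : 0 <= LHS by apply: sumr_ge0 => z _; exact: sqr_ge0.
rewrite -(ger0_norm L0) -normc_real.
have -> : (LHS%:C)%C = \sum_(j < K) \sum_(j' < K)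
    \sum_z expi ((j%:R - j'%:R) * ph z).
  rewrite (eq_bigr (fun j : 'I_K => \sum_z \sum_(j' < K)
    expi ((j%:R - j'%:R) * ph z))) => [|j _]; last exact: exchange_big.
  rewrite exchange_big /LHS rmorph_sum /=; apply: eq_bigr => z _.
  rewrite normc_sqr /geosum rmorph_sum /= mulr_suml; apply: eq_bigr => j _.
  rewrite mulr_sumr; apply: eq_bigr => j' _.
  by rewrite expi_conj -expiD; congr expi; ring.
apply: le_trans (normc_sum _ _ _) _.
apply: (@le_trans _ _ (\sum_(j < K) 2 * \sum_(0 <= s < K) B s)); last first.
  rewrite sumr_const card_ord -[_ *+ _]mulr_natl le_eqVlt; apply/orP; left.
  by apply/eqP; ring.
apply: ler_sum => j _; apply: le_trans (normc_sum _ _ _) _.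
apply: le_trans (sum_dist_le B0 (ltn_ord j)); apply: ler_sum => j' _.
have jK := ltn_ord j; have jK' := ltn_ord j'.
case: (leqP j' j) => jj.
  have -> : (j - j' + (j' - j) = j - j')%N by lia.
  by rewrite -natrB//; apply: BP; lia.
have -> : (j - j' + (j' - j) = j' - j)%N by lia.
have := BP (j' - j)%N; rewrite natrB ?(ltnW jj)// => h.
apply: le_trans (h _); last by lia.
rewrite -normc_conj rmorph_sum /= le_eqVlt; apply/orP; left; apply/eqP.
congr normc; apply: eq_bigr => z _; rewrite expi_conj; congr expi; ring.
Qed.

(** Take for L the smaller of L0 and the integral part of 1/w; the latter is at least
    1/(2w) because w <= 1. *)
Lemma exists_averaging_length (L0 : nat) (w : R) : (0 < L0)%N -> 0 < w -> w <= 1 ->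
  exists L, [/\ (0 < L)%N, (L <= L0)%N, L%:R * w <= 1 &
    L%:R^-1 <= L0%:R^-1 + 2 * w].
Proof.
move=> L00 w0 w1; set t := Num.truncn w^-1.
have t1 : 1 <= w^-1 by rewrite -invr1 lef_pV2 ?posrE.
have /andP[h1 h2] : t%:R <= w^-1 < t.+1%:R.
  by apply: truncn_itv; rewrite (le_trans _ t1).
have t0 : (0 < t)%N.
  by rewrite -ltnS -(ltr_nat R) (le_lt_trans t1).
have tw : t%:R * w <= 1 by rewrite -ler_pdivlMr// mul1r.
have tw2 : t%:R^-1 <= 2 * w.
  rewrite invf_ple ?posrE ?ltr0n ?mulr_gt0// invfM.
  have : t.+1%:R <= 2 * t%:R :> R by rewrite -natrM ler_nat; lia.
  lra.
have i0 : 0 <= L0%:R^-1 :> R by rewrite invr_ge0.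
have [tL|Lt] := leqP t L0.
  by exists t; split => //; lra.
exists L0; split => //; last lra.
by apply: le_trans tw; rewrite ler_pM2r// ler_nat ltnW.
Qed.

Lemma sum_inv_sqrt_le n :
  \sum_(0 <= s < n) (Num.sqrt (s.+1%:R : R))^-1 <= 2 * Num.sqrt n%:R.
Proof.
elim: n => [|n IH]; first by rewrite big_geq// sqrtr0 mulr0.
rewrite big_nat_recr//=; apply: le_trans (lerD IH (lexx _)) _.
have h1 := sqr_sqrtr (ler0n R n); have h2 := sqr_sqrtr (ler0n R n.+1).
have p1 := sqrtr_ge0 (n%:R : R).
have p2 : 0 < Num.sqrt (n.+1%:R : R) by rewrite sqrtr_gt0.
move: h1 h2 p1 p2; rewrite -natr1; set x := Num.sqrt n%:R; set y := Num.sqrt _.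
move=> h1 h2 p1 p2.
have := sqr_ge0 (y - x) => h3.
rewrite -(ler_pM2r p2) mulrDl mulVf ?gt_eqF//; nra.
Qed.

Lemma exprD_le_pow2 (a b : R) n : 0 <= a -> 0 <= b ->
  (a + b) ^+ n <= 2 ^+ n * (a ^+ n + b ^+ n).
Proof.
wlog ab : a b / a <= b.
  by move=> H a0 b0; case: (leP a b) => [|/ltW] ab; [|rewrite addrC [_ ^+ n + _]addrC]; exact: H.
move=> a0 b0; apply: (@le_trans _ _ ((2 * b) ^+ n)).
  by rewrite lerXn2r ?nnegrE ?addr_ge0 ?mulr_ge0//; lra.
by rewrite exprMn ler_wpM2l ?exprn_ge0// lerDr exprn_ge0.
Qed.

End NearIntegers.

(** * Bounds for each frequency *)

Section Frequencies.
Variable R : realType.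

(** Bound for the sum of frequency s over two sets of at most m^D points: trivial for
    s = 0, and for s > 0 smaller by the square root of the D-th power of
    s lam + 1 / (s lam m^2), up to a constant. *)
Definition freq_bound (D m : nat) (lam : R) (s : nat) : R :=
  m%:R ^+ (2 * D) * (if s == 0 then 1 else
    Num.sqrt (2 ^+ 15 * (s%:R * lam + (s%:R * lam * m%:R ^+ 2)^-1)) ^+ D).

Lemma freq_bound_ge0 D m lam s : 0 <= freq_bound D m lam s.
Proof.
apply: mulr_ge0; first exact: exprn_ge0.
by case: ifP => // _; apply: exprn_ge0; exact: sqrtr_ge0.
Qed.

(** [bilinear_sum_le] with kap = 2 pi s lam / L0 and L about 1 / (m kap). With
    mu = 4 pi s lam m, the two factors that depend on s are at most 2m (1 + mu) and
    1 + 1/mu, and their product is at most 4m (mu + 1/mu). *)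
Lemma frequency_sum_le (D m K L0 s : nat) (I J : finType)
    (ci : I -> {ffun 'I_D -> 'I_m}) (cj : J -> {ffun 'I_D -> 'I_m})
    (g : I -> 'I_D -> nat) (y : J -> 'I_D -> R)
    (al : I -> R) (be : J -> R) (lam : R) :
  injective ci -> injective cj -> (0 < m)%N -> (0 < L0)%N -> 0 < lam ->
  8 * K%:R * lam * m%:R <= L0%:R ->
  (forall p k, (ci p k * L0 <= g p k < (ci p k).+1 * L0)%N) ->
  (forall q k, (cj q k)%:R <= y q k < (cj q k)%:R + 1) ->
  (s < K)%N ->
  normc (\sum_z expi (s%:R * (2 * pi *
     (al z.1 + be z.2 - lam / L0%:R * \sum_k (g z.1 k)%:R * y z.2 k))))
  <= freq_bound D m lam s.
Proof.
move=> ciI cjI m0 L00 lam0 L0P gP yP sK.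
have mp : 0 < m%:R :> R by rewrite ltr0n.
have Lp : 0 < L0%:R :> R by rewrite ltr0n.
rewrite /freq_bound; have [->|s0] := eqVneq s 0%N.
  apply: le_trans (normc_sum _ _ _) _.
  under eq_bigr do rewrite normc_expi.
  rewrite sumr_const -[_ *+ _]mulr_natl !mulr1 cardT -cardE card_prod.
  rewrite mulnC exprM expr2 -natrM -natrX ler_nat expnMn.
  have := leq_card ci ciI; have := leq_card cj cjI; rewrite card_ffun !card_ord.
  exact: leq_mul.
have sp : 0 < s%:R :> R by rewrite ltr0n lt0n.
have pip : 0 < pi :> R by exact: pi_gt0.
set kap := - (s%:R * (2 * pi * lam / L0%:R)).
have kE : `|kap| = s%:R * (2 * pi * lam / L0%:R).
  by rewrite normrN ger0_norm// !mulr_ge0// ?ltW// invr_gt0.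
have kp : 0 < `|kap| by rewrite kE !mulr_gt0// invr_gt0.
have w1 : m%:R * `|kap| <= 1.
  rewrite kE.
  have -> : m%:R * (s%:R * (2 * pi * lam / L0%:R)) = (m%:R * s%:R * 2 * pi * lam) / L0%:R.
    by rewrite !mulrA.
  rewrite ler_pdivrMr// mul1r; apply: le_trans L0P.
  have h1 : s%:R <= K%:R :> R by rewrite ler_nat ltnW.
  have h2 : pi <= 4 :> R by have := pihalf_lt2 R; lra.
  have h3 : s%:R * pi <= K%:R * 4 :> R by apply: ler_pM => //; exact: ltW.
  have h4 : 0 <= 2 * m%:R * lam by rewrite !mulr_ge0// ltW.
  by have := ler_wpM2l h4 h3; lra.
have [L [Lp0 LL0 Lw Linv]] := exists_averaging_length L00 (mulr_gt0 mp kp) w1.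
have Lpp : 0 < L%:R :> R by rewrite ltr0n.
set S := (X in normc X).
have SE : S = \sum_p \sum_q expi (s%:R * (2 * pi * al p)) * expi (s%:R * (2 * pi * be q)) *
    expi (kap * \sum_k (g p k)%:R * y q k).
  rewrite pair_bigA; apply: eq_bigr => z _ /=; rewrite -!expiD; congr expi.
  by rewrite /kap; ring.
have -> : 2 ^+ 15 = 2 ^+ 9 * 64 :> R by ring.
set c : R := 2 ^+ 9; have cp : 0 < c by exact: exprn_gt0.
set X := c * 64 * (_ + _).
have e1 p : normc (expi (s%:R * (2 * pi * al p))) <= 1 by rewrite normc_expi.
have e2 q : normc (expi (s%:R * (2 * pi * be q))) <= 1 by rewrite normc_expi.
have k0 : kap != 0 by rewrite -normr_gt0.
have := bilinear_sum_le ciI cjI m0 Lp0 LL0 gP yP e1 e2 k0 Lw erefl.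
rewrite -SE -/c; set Y := c * _ * _ * _ => HS.
clearbody c.
set mu := 4 * pi * s%:R * lam * m%:R.
have mup : 0 < mu by rewrite !mulr_gt0.
have YX : Y <= m%:R ^+ 4 * X.
  rewrite /Y; have -> : (2 * m%:R * L0%:R * `|kap|)^-1 = mu^-1.
    by rewrite kE /mu; congr (_^-1); field; rewrite gt_eqF.
  have h1 : 2 * m%:R * L0%:R / L%:R <= 2 * m%:R * (1 + mu).
    rewrite -mulrA ler_pM2l ?mulr_gt0//.
    apply: (@le_trans _ _ (L0%:R * (L0%:R^-1 + 2 * (m%:R * `|kap|)))).
      by rewrite ler_pM2l.
    rewrite kE /mu le_eqVlt; apply/orP; left; apply/eqP; field; by rewrite gt_eqF.
  have im0 : 0 < mu^-1 by rewrite invr_gt0.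
  apply: (@le_trans _ _ (c * m%:R ^+ 2 * (2 * m%:R * (1 + mu)) * (1 + mu^-1))).
    rewrite ler_pM2r; last exact: addr_gt0.
    by rewrite ler_pM2l// mulr_gt0// exprn_gt0.
  have h2 : (1 + mu) * (1 + mu^-1) <= 2 * (mu + mu^-1).
    have h3 : 0 <= (mu - 1) ^+ 2 * mu^-1 by rewrite mulr_ge0 ?sqr_ge0 ?ltW.
    have h4 : (mu - 1) ^+ 2 * mu^-1 = mu + mu^-1 - 2 by field; rewrite gt_eqF.
    have h5 : (1 + mu) * (1 + mu^-1) = 2 + mu + mu^-1 by field; rewrite gt_eqF.
    by rewrite h4 in h3; rewrite h5; lra.
  set A := s%:R * lam * m%:R.
  have Ap : 0 < A by rewrite !mulr_gt0.
  have pi4 : pi <= 4 :> R by have := pihalf_lt2 R; lra.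
  have h6 : mu <= 16 * A.
    have : (4 * A) * pi <= (4 * A) * 4 by rewrite ler_pM2l// mulr_gt0.
    by rewrite /mu /A; lra.
  have h7 : mu^-1 <= A^-1.
    rewrite lef_pV2 ?posrE//.
    have : A * 1 <= A * (4 * pi) by rewrite ler_pM2l//; have := pi_ge2 R; lra.
    by rewrite /mu /A; lra.
  have -> : m%:R ^+ 4 * X = c * 64 * m%:R ^+ 3 * (A + A^-1).
    by rewrite /X /A; field; rewrite !gt_eqF.
  apply: (@le_trans _ _ (c * 2 * m%:R ^+ 3 * (2 * (mu + mu^-1)))).
    have m3 : 0 <= c * 2 * m%:R ^+ 3 by rewrite !mulr_ge0 ?exprn_ge0// ltW.
    by have := ler_wpM2l m3 h2; lra.
  have iA : 0 < A^-1 by rewrite invr_gt0.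
  have m3 : 0 <= c * m%:R ^+ 3 by rewrite mulr_ge0 ?exprn_ge0// ltW.
  have h8 : 4 * (mu + mu^-1) <= 64 * (A + A^-1) by lra.
  by have := ler_wpM2l m3 h8; lra.
have Y0 : 0 <= Y.
  rewrite /Y; apply: mulr_ge0; last by rewrite addr_ge0// invr_ge0 !mulr_ge0.
  by rewrite !mulr_ge0// ?invr_ge0// ?exprn_ge0// ltW.
have X0 : 0 <= X.
  have lam0' := ltW lam0; have cp' := ltW cp.
  by rewrite /X; apply: mulr_ge0; rewrite ?addr_ge0 ?invr_ge0 ?mulr_ge0 ?exprn_ge0.
rewrite -(@ler_pXn2r _ 2)// ?nnegrE ?normc_ge0//.
apply: le_trans HS _; apply: (@le_trans _ _ ((m%:R ^+ 4 * X) ^+ D)).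
  by apply: lerXn2r => //; rewrite nnegrE; apply: mulr_ge0 => //; exact: exprn_ge0.
rewrite le_eqVlt; apply/orP; left; apply/eqP.
rewrite exprMn [RHS]exprMn -!exprM; congr (_ * _).
  by rewrite [(2 * D * 2)%N]mulnAC.
by rewrite [(D * 2)%N]mulnC exprM sqr_sqrtr.
Qed.

(** The square roots separate the two parts of [freq_bound]. The first part grows with
    s and is bounded by its value at K. The second one decays like s^(-D/2), hence at
    least like s^(-1/2), whose sum is at most 2 sqrt K. *)
Lemma sum_freq_bound_le (D m K : nat) (lam : R) :
  (0 < D)%N -> (0 < m)%N -> (0 < K)%N -> 0 < lam ->
  \sum_(0 <= s < K) freq_bound D m lam s <=
    2 * (2 ^+ 9) ^+ D * m%:R ^+ (2 * D) *
    (1 + K%:R * Num.sqrt (K%:R * lam) ^+ D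
       + Num.sqrt K%:R / (m%:R * Num.sqrt lam) ^+ D).
Proof.
move=> D0 m0 K0 lam0.
have mp : 0 < m%:R :> R by rewrite ltr0n.
have slp : 0 < Num.sqrt lam by rewrite sqrtr_gt0.
set V := Num.sqrt (K%:R * lam) ^+ D.
set U := ((m%:R * Num.sqrt lam) ^+ D)^-1.
have V0 : 0 <= V by rewrite exprn_ge0 ?sqrtr_ge0.
have U0 : 0 <= U by rewrite invr_ge0 exprn_ge0// mulr_ge0 ?sqrtr_ge0.
have M0 : 0 <= m%:R ^+ (2 * D) :> R by rewrite exprn_ge0.
set c : R := 2 ^+ 9.
have c1 : 1 <= c by rewrite exprn_ege1// ler1n.
have P1 : 1 <= c ^+ D by rewrite exprn_ege1.
have term s : (s.+1 < K)%N -> freq_bound D m lam s.+1 <=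
   c ^+ D * m%:R ^+ (2 * D) * (V + U * (Num.sqrt s.+1%:R)^-1).
  move=> sK; rewrite /freq_bound /=.
  set e : R := 2 ^+ 15; pose f : R := 2 ^+ 8.
  have cf : 2 * f = c by rewrite /c /f; ring.
  have ef : f ^+ 2 = 2 * e by rewrite /e /f; ring.
  have e0 : 0 <= e by exact: exprn_ge0.
  have f0 : 0 <= f by exact: exprn_ge0.
  clearbody e f. rewrite [c ^+ D * _]mulrC -[leRHS]mulrA ler_wpM2l//.
  have sp : 0 < s.+1%:R :> R by rewrite ltr0n.
  have ssp : 0 < Num.sqrt (s.+1%:R : R) by rewrite sqrtr_gt0.
  have ss1 : 1 <= Num.sqrt (s.+1%:R : R) by rewrite -[leLHS]sqrtr1 ler_wsqrtr// ler1n.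
  set a := Num.sqrt (K%:R * lam); set b := (m%:R * Num.sqrt lam * Num.sqrt s.+1%:R)^-1.
  have a0 : 0 <= a by exact: sqrtr_ge0.
  have b0 : 0 <= b by rewrite invr_ge0 !mulr_ge0 ?sqrtr_ge0.
  have -> : (s.+1%:R * lam * m%:R ^+ 2)^-1 = b ^+ 2.
    by rewrite /b exprVn !exprMn !sqr_sqrtr ?ler0n// ?ltW//; congr (_^-1); ring.
  have h1 : Num.sqrt (e * (s.+1%:R * lam + b ^+ 2)) <= f * (a + b).
    have c0 : 0 <= f * (a + b) by rewrite mulr_ge0// addr_ge0.
    rewrite -(ger0_norm c0) -sqrtr_sqr ler_wsqrtr//.
    have : s.+1%:R * lam <= a ^+ 2.
      rewrite sqr_sqrtr; last by rewrite mulr_ge0// ltW.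
      by rewrite ler_pM2r// ler_nat ltnW.
    move=> h.
    have h' := mulr_ge0 a0 b0; have a2 := sqr_ge0 a; have b2 := sqr_ge0 b.
    rewrite exprMn ef -mulrA mulrCA ler_wpM2l//.
    by rewrite sqrrD -mulr_natl; lra.
  apply: (@le_trans _ _ ((f * (a + b)) ^+ D)).
    by rewrite lerXn2r ?nnegrE ?sqrtr_ge0 ?mulr_ge0 ?addr_ge0.
  rewrite exprMn; apply: le_trans (ler_wpM2l (exprn_ge0 _ _) (exprD_le_pow2 _ a0 b0)) _ => //.
  rewrite mulrA -exprMn [f * 2]mulrC cf ler_wpM2l ?(le_trans ler01 P1)// lerD2l.
  rewrite /b exprVn exprMn invfM /U ler_wpM2l//.
  rewrite lef_pV2 ?posrE ?exprn_gt0//.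
  by rewrite -[leLHS]expr1 ler_weXn2l.
rewrite big_ltn//=.
have F0 : freq_bound D m lam 0 = m%:R ^+ (2 * D) by rewrite /freq_bound mulr1.
rewrite F0; case: K K0 @V V0 term => // K _ V V0 term.
rewrite -[X in \sum_(X <= _ < _) _](add0n 1%N) big_addn subn1 /=.
apply: (@le_trans _ _ (m%:R ^+ (2 * D) + \sum_(0 <= s < K)
    c ^+ D * m%:R ^+ (2 * D) * (V + U * (Num.sqrt s.+1%:R)^-1))).
  rewrite lerD2l; apply: ler_sum_nat => s /andP[_ sK].
  by rewrite addn1; apply: term.
rewrite -mulr_sumr big_split /= -mulr_sumr sumr_const_nat subn0 -[V *+ K]mulr_natl.
have h2 := ler_wpM2l U0 (sum_inv_sqrt_le R K).
have h3 : Num.sqrt (K%:R : R) <= Num.sqrt K.+1%:R by rewrite ler_wsqrtr// ler_nat.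
have h4 : K%:R * V <= K.+1%:R * V by rewrite ler_wpM2r// ler_nat.
have h5 := ler_wpM2l U0 h3.
set A := c ^+ D * m%:R ^+ (2 * D).
have A0 : 0 <= A by rewrite mulr_ge0// (le_trans ler01 P1).
have MA : m%:R ^+ (2 * D) <= A by rewrite ler_peMl.
have h6 : K%:R * V + U * \sum_(0 <= i < K) (Num.sqrt i.+1%:R)^-1 <=
     2 * (K.+1%:R * V + U * Num.sqrt K.+1%:R).
  have : 0 <= K.+1%:R * V by rewrite mulr_ge0.
  by lra.
have := ler_wpM2l A0 h6.
clearbody c; rewrite -[2 * c ^+ D * _]mulrA -/A [_ / _]mulrC -/U; lra.
Qed.
End Frequencies.

(** * Almost integral values of bilinear forms *)

Section BilinearCount.
Variable R : realType.

Lemma card_cover_le (I J : finType) (S : {set I}) (F : J -> {set I}) :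
  (forall z, z \in S -> exists j, z \in F j) -> (#|S| <= \sum_j #|F j|)%N.
Proof.
move=> H; rewrite -sum1_card.
under [X in (_ <= X)%N]eq_bigr do rewrite -sum1_card big_mkcond.
rewrite exchange_big /= big_mkcond; apply: leq_sum => z _.
case: ifP => // /H[j zj]; rewrite (bigD1 j)//= zj; exact: leq_addr.
Qed.

(** How often al p + be q - lam x.y is almost an integer, for points x and y lying one per
    unit cell of [0,m)^D and arbitrary labels. The first of the three terms is the
    expected count, a proportion 1/K of all pairs.

    The points x are first moved to a lattice of spacing 1/L0, so fine that the form
    changes by at most 1/K; the tolerance absorbs this. The enlarged tolerance (T+1)/K
    exceeds the 1/(8K) of the Fejer kernel, but it is covered by N translates of it, and
    a translation is a change of the labels. *)
Lemma bilinear_count (D T : nat) : (0 < D)%N -> exists2 C : R, 0 <= C &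
  forall (m K : nat) (I J : finType)
    (ci : I -> {ffun 'I_D -> 'I_m}) (cj : J -> {ffun 'I_D -> 'I_m})
    (x : I -> 'I_D -> R) (y : J -> 'I_D -> R)
    (al : I -> R) (be : J -> R) (lam : R),
  injective ci -> injective cj -> (0 < m)%N -> (0 < K)%N -> 0 < lam ->
  (forall p k, (ci p k)%:R <= x p k < (ci p k)%:R + 1) ->
  (forall q k, (cj q k)%:R <= y q k < (cj q k)%:R + 1) ->
  #|[set z | asbool (near_int (T%:R / K%:R)
       (al z.1 + be z.2 - lam * \sum_k x z.1 k * y z.2 k))]|%:R
  <= C * (m%:R ^+ (2 * D) / K%:R *
       (1 + K%:R * Num.sqrt (K%:R * lam) ^+ D
       + Num.sqrt K%:R / (m%:R * Num.sqrt lam) ^+ D)).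
Proof.
move=> D0; pose N := (16 * T.+1).+1.
exists (N%:R * 16 * (2 ^+ 9) ^+ D).
  by apply: mulr_ge0 => //; apply: exprn_ge0; apply: exprn_ge0.
move=> m K I J ci cj x y al be lam ciI cjI m0 K0 lam0 xP yP.
have mp : 0 < m%:R :> R by rewrite ltr0n.
have Kp : 0 < K%:R :> R by rewrite ltr0n.
(* The factor 8 >= 2 pi keeps the phases kap m below 1 for all frequencies below K,
   the factor D.+1 bounds the error from rounding x by 1/K. *)
pose big := 8 * K%:R * lam * m%:R * D.+1%:R.
have big0 : 0 < big by rewrite !mulr_gt0.
pose L0 := Num.bound big.
have L0P : big < L0%:R by apply: archi_boundP; exact: ltW.
have L0p : 0 < L0%:R :> R by apply: lt_trans L0P.
have L00 : (0 < L0)%N by rewrite -(ltr_nat R).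
have A0 : 0 < K%:R * lam * m%:R by rewrite !mulr_gt0.
have L01 : 8 * K%:R * lam * m%:R <= L0%:R.
  apply: le_trans (ltW L0P); rewrite /big ler_peMr ?ler1n//.
  by rewrite -!mulrA mulr_ge0// !mulrA ltW.
have L02 : K%:R * lam * m%:R * D%:R <= L0%:R.
  apply: le_trans (ltW L0P).
  have -> : big = K%:R * lam * m%:R * (8 * D.+1%:R) by rewrite /big; ring.
  by rewrite ler_pM2l// -natrM ler_nat; lia.
pose g p k := Num.truncn (x p k * L0%:R).
have x0 p k : 0 <= x p k by have /andP[h _] := xP p k; apply: le_trans h.
have gx p k : (g p k)%:R <= x p k * L0%:R < (g p k)%:R + 1.
  by rewrite natr1; apply: truncn_itv; rewrite mulr_ge0.
have gP p k : (ci p k * L0 <= g p k < (ci p k).+1 * L0)%N.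
  have /andP[h1 h2] := xP p k; have /andP[h3 h4] := gx p k.
  apply/andP; split.
    rewrite -ltnS -(ltr_nat R) -natr1 natrM; apply: le_lt_trans h4.
    by rewrite ler_pM2r.
  rewrite -(ltr_nat R) natrM -natr1; apply: le_lt_trans h3 _.
  by rewrite ltr_pM2r.
(* Tolerance intervals of half-width 1/(8K) centred at multiples of 1/(8K), from
   -(T+1)/K to (T+1)/K. *)
pose th (t : 'I_N) (z : I * J) := (al z.1 + (T.+1%:R / K%:R - t%:R / (8 * K%:R))) +
  be z.2 - lam / L0%:R * \sum_k (g z.1 k)%:R * y z.2 k.
have cnt t : #|[set z | asbool (near_int (8 * K%:R)^-1 (th t z))]|%:R <=
    8 / K%:R * \sum_(0 <= s < K) freq_bound D m lam s.
  apply: le_trans (card_near_int_le _ K0) _.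
  have -> : 8 / K%:R * \sum_(0 <= s < K) freq_bound D m lam s =
     4 / K%:R ^+ 2 * (2 * K%:R * \sum_(0 <= s < K) freq_bound D m lam s).
    by field; rewrite gt_eqF.
  rewrite ler_wpM2l ?divr_ge0 ?exprn_ge0//.
  apply: sum_sqr_geosum_le => s; first exact: freq_bound_ge0.
  move=> sK.
  by apply: (@frequency_sum_le R D m K L0 s I J ci cj g y
    (fun p => al p + (T.+1%:R / K%:R - t%:R / (8 * K%:R))) be lam).
have cov : (#|[set z | asbool (near_int (T%:R / K%:R)
       (al z.1 + be z.2 - lam * \sum_k x z.1 k * y z.2 k))]| <=
    \sum_(t < N) #|[set z | asbool (near_int (8 * K%:R)^-1 (th t z))]|)%N.
  apply: card_cover_le => z; rewrite inE => /asboolP[w hw].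
  set S := \sum_k x z.1 k * y z.2 k in hw.
  pose S' := \sum_k (g z.1 k)%:R * y z.2 k.
  have SS : `|lam * S - lam / L0%:R * S'| <= K%:R^-1.
    have -> : lam * S - lam / L0%:R * S' =
      lam / L0%:R * \sum_k (x z.1 k * L0%:R - (g z.1 k)%:R) * y z.2 k.
      rewrite (eq_bigr (fun k => L0%:R * (x z.1 k * y z.2 k) - (g z.1 k)%:R * y z.2 k)).
        by rewrite sumrB -mulr_sumr -/S -/S'; field; rewrite gt_eqF.
      by move=> k _; ring.
    have lL : 0 <= lam / L0%:R by apply: divr_ge0; exact: ltW.
    rewrite normrM (ger0_norm lL).
    apply: (@le_trans _ _ (lam / L0%:R * (m%:R * D%:R))).
      rewrite ler_wpM2l//.
      apply: le_trans (ler_norm_sum _ _ _) _.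
      rewrite mulr_natr -[D in leRHS]card_ord -sumr_const; apply: ler_sum => k _.
      have /andP[h1 h2] := gx z.1 k; have /andP[h3 h4] := yP z.2 k.
      have y0 : 0 <= y z.2 k by apply: le_trans h3.
      have ym : y z.2 k <= m%:R.
        by apply: le_trans (ltW h4) _; rewrite natr1 ler_nat ltn_ord.
      rewrite normrM (ger0_norm y0) -[leRHS]mul1r ler_pM//.
      by rewrite ger0_norm; lra.
    rewrite mulrAC ler_pdivrMr// -ler_pdivrMl ?invr_gt0// invrK.
    by rewrite !mulrA.
  pose e := al z.1 + be z.2 - lam / L0%:R * S' - w%:~R.
  have eb : `|e| <= T.+1%:R / K%:R.
    have -> : e = (al z.1 + be z.2 - lam * S - w%:~R) + (lam * S - lam / L0%:R * S').
      by rewrite /e; ring.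
    apply: le_trans (ler_normD _ _) _; apply: le_trans (lerD hw SS) _.
    by rewrite -natr1 mulrDl mul1r.
  have K8 : 0 < 8 * K%:R :> R by rewrite mulr_gt0.
  have e0 : 0 <= (e + T.+1%:R / K%:R) * (8 * K%:R).
    by apply: mulr_ge0 (ltW K8); move: eb; rewrite ler_norml => /andP[h _]; lra.
  have /andP[t1 t2] := truncn_itv e0; set t := Num.truncn _ in t1 t2.
  have tN : (t < N)%N.
    rewrite /N ltnS -(ler_nat R); apply: le_trans t1 _.
    apply: (@le_trans _ _ ((T.+1%:R / K%:R + T.+1%:R / K%:R) * (8 * K%:R))).
      by rewrite ler_pM2r// lerD2r; move: eb; rewrite ler_norml => /andP[].
    rewrite natrM le_eqVlt; apply/orP; left; apply/eqP; field; by rewrite gt_eqF.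
  exists (Ordinal tN); rewrite inE; apply/asboolP; exists w; rewrite /th /= -/S'.
  have -> : al z.1 + (T.+1%:R / K%:R - t%:R / (8 * K%:R)) + be z.2 - lam / L0%:R * S' - w%:~R
     = ((e + T.+1%:R / K%:R) * (8 * K%:R) - t%:R) / (8 * K%:R).
    by rewrite /e; field; rewrite !gt_eqF.
  rewrite normrM [ `|_^-1|]ger0_norm ?invr_ge0 ?(ltW K8)// ler_piMl ?invr_ge0 ?(ltW K8)//.
  by rewrite -natr1 in t2; rewrite ger0_norm; lra.
have cov' : #|[set z | asbool (near_int (T%:R / K%:R)
       (al z.1 + be z.2 - lam * \sum_k x z.1 k * y z.2 k))]|%:R <=
   N%:R * (8 / K%:R * \sum_(0 <= s < K) freq_bound D m lam s).
  apply: (@le_trans _ _ (\sum_(t < N)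
     #|[set z | asbool (near_int (8 * K%:R)^-1 (th t z))]|%:R)).
    by rewrite -natr_sum ler_nat.
  apply: le_trans (ler_sum _ (fun t _ => cnt t)) _.
  by rewrite sumr_const card_ord -[_ *+ N]mulr_natl.
apply: le_trans cov' _; have := sum_freq_bound_le D0 m0 K0 lam0.
set V := 1 + _ + _ => h.
have -> : N%:R * 16 * (2 ^+ 9) ^+ D * (m%:R ^+ (2 * D) / K%:R * V) =
  N%:R * (8 / K%:R * (2 * (2 ^+ 9) ^+ D * m%:R ^+ (2 * D) * V)).
  by move: ((2 ^+ 9) ^+ D) (m%:R ^+ (2 * D)) => A B; field; rewrite gt_eqF.
by rewrite ler_wpM2l// ler_wpM2l// divr_ge0.
Qed.
End BilinearCount.

(** * From distances to bilinear forms *)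

Section CellPairs.
Variable R : realType.

(** (r^2 - h^2) / (2h) equals both u + (u^2 + V) / (2h) and (r - h) + (r - h)^2 / (2h).
    Thus r - h may be replaced by u + V / (2h), which unlike r is quadratic in the
    coordinates; the squares of u and r - h are the error. *)
Lemma near_int_phase (r u V h del : R) : 0 < h ->
  0 <= r -> r ^+ 2 = (h + u) ^+ 2 + V ->
  near_int del (r - h) ->
  near_int (del + u ^+ 2 / (2 * h) + (r - h) ^+ 2 / (2 * h)) (u + V / (2 * h)).
Proof.
move=> h0 r0 E [z hz]; exists z.
have -> : u + V / (2 * h) - z%:~R =
  (r - h - z%:~R) + ((r - h) ^+ 2 / (2 * h) - u ^+ 2 / (2 * h)).
  have -> : V = r ^+ 2 - (h + u) ^+ 2 by rewrite E addrC addKr.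
  by field; rewrite gt_eqF.
have p1 : 0 <= u ^+ 2 / (2 * h) by rewrite divr_ge0 ?sqr_ge0// mulr_ge0// ltW.
have p2 : 0 <= (r - h) ^+ 2 / (2 * h) by rewrite divr_ge0 ?sqr_ge0// mulr_ge0// ltW.
move: hz p1 p2; move: (r - h - _) (_ / _) (_ / _) => a b b' ha hb hb'.
by move: ha; rewrite !ler_norml => /andP[h1 h2]; apply/andP; split; lra.
Qed.

(** The factorization (r - h)(r + h) = u (2h + u) + V gives |r - h| <= 8 + V/h, so that
    K = O(h) and V^2 K = O(h^3) make both error terms of [near_int_phase] O(1/K). *)
Lemma near_int_phase_le (r u V h del K a : R) : 0 < K -> 1 <= h -> 0 <= a ->
  0 <= V -> `|u| <= 2 -> 0 <= r -> r ^+ 2 = (h + u) ^+ 2 + V ->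
  K <= a * h -> V ^+ 2 * K <= a * h ^+ 3 ->
  near_int (del / K) (r - h) ->
  near_int ((del + 67 * a) / K) (u + V / (2 * h)).
Proof.
move=> K0 h1 a0 V0 u2 r0 E Kh VK nr.
have h0 : 0 < h by lra.
have [z hz] := near_int_phase h0 r0 E nr; exists z; apply: le_trans hz _.
have [u1 u3] : - 2 <= u /\ u <= 2 by move: u2; rewrite ler_norml => /andP.
have uu : u ^+ 2 <= 4 by nra.
have rh : (r - h) ^+ 2 <= (8 + V / h) ^+ 2.
  have e0 : 0 <= V / h by rewrite divr_ge0// ltW.
  rewrite -real_normK ?num_real// ler_pXn2r ?nnegrE ?addr_ge0//.
  have e1 : `|r - h| * h <= (8 + V / h) * h.
    apply: (@le_trans _ _ (`|r - h| * (r + h))); first by rewrite ler_wpM2l//; lra.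
    rewrite -[X in _ * X]ger0_norm ?addr_ge0 ?(ltW h0)// -normrM.
    have -> : (r - h) * (r + h) = u * (2 * h + u) + V.
      by transitivity (r ^+ 2 - h ^+ 2); [ring | rewrite E; ring].
    have -> : (8 + V / h) * h = 8 * h + V by field; rewrite gt_eqF.
    rewrite ler_norml; apply/andP; split; nra.
  by move: e1; rewrite ler_pM2r.
have b1 : u ^+ 2 / (2 * h) <= 2 * a / K.
  rewrite ler_pdivrMr ?mulr_gt0// mulrAC ler_pdivlMr//; nra.
have b2 : (r - h) ^+ 2 / (2 * h) <= 65 * a / K.
  rewrite ler_pdivrMr ?mulr_gt0// mulrAC ler_pdivlMr//.
  apply: le_trans (ler_wpM2r (ltW K0) rh) _.
  have e2 : (8 + V / h) ^+ 2 * K <= (128 + 2 * (V / h) ^+ 2) * K.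
    rewrite ler_pM2r//; have := sqr_ge0 (8 - V / h); lra.
  apply: le_trans e2 _; rewrite mulrDl.
  have e3 : (V / h) ^+ 2 * K <= a * h.
    rewrite expr_div_n mulrAC ler_pdivrMr ?exprn_gt0//.
    by apply: le_trans VK _; rewrite -mulrA -exprS.
  by rewrite -mulrA; lra.
have -> : (del + 67 * a) / K = del / K + 2 * a / K + 65 * a / K.
  by field; rewrite gt_eqF.
lra.
Qed.

(** Two boxes at distance about h: x1 and y1 are coordinates along the axis, x and y
    transversal ones, and o, o' are the corners of the boxes in units of the cell side
    1/N. Expanding V around the corners, the phase of [near_int_phase] splits into a
    function of the first point, a function of the second one and the bilinear form
    x'.y' / (h N^2) in the coordinates relative to the corners. *)
Lemma cell_pair_count (D T N : nat) (a : R) : (0 < D)%N -> (0 < N)%N -> 0 <= a ->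
  exists2 C : R, 0 <= C &
  forall (m K h : nat) (I J : finType)
    (ci : I -> {ffun 'I_D -> 'I_m}) (cj : J -> {ffun 'I_D -> 'I_m})
    (o o' : 'I_D -> R) (x : I -> 'I_D -> R) (y : J -> 'I_D -> R)
    (x1 : I -> R) (y1 : J -> R) (r : I * J -> R) (S : {set I * J}),
  injective ci -> injective cj -> (0 < m)%N -> (0 < K)%N -> (0 < h)%N ->
  (forall p k, (ci p k)%:R <= N%:R * x p k - o k < (ci p k)%:R + 1) ->
  (forall q k, (cj q k)%:R <= N%:R * y q k - o' k < (cj q k)%:R + 1) ->
  K%:R <= a * h%:R ->
  (forall z, z \in S ->
    let V := \sum_k (x z.1 k - y z.2 k) ^+ 2 in
    [/\ `|x1 z.1 - y1 z.2 - h%:R| <= 2, 0 <= r z,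
     r z ^+ 2 = (x1 z.1 - y1 z.2) ^+ 2 + V,
     V ^+ 2 * K%:R <= a * h%:R ^+ 3 & near_int (T%:R / K%:R) (r z)]) ->
  #|S|%:R <= C * (m%:R ^+ (2 * D) / K%:R *
       (1 + K%:R * Num.sqrt (K%:R / (h%:R * N%:R ^+ 2)) ^+ D
       + Num.sqrt K%:R / (m%:R / Num.sqrt (h%:R * N%:R ^+ 2)) ^+ D)).
Proof.
move=> D0 N0 a0.
pose T' := Num.bound (T%:R + 67 * a).
have T'P : T%:R + 67 * a <= T'%:R by rewrite ltW// archi_boundP// addr_ge0// mulr_ge0.
have [C C0 CP] := bilinear_count R T' D0.
exists C => // m K h I J ci cj o o' x y x1 y1 r S ciI cjI m0 K0 h0 xP yP Kh SP.
have Np : 0 < N%:R :> R by rewrite ltr0n.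
have hp : 0 < h%:R :> R by rewrite ltr0n.
have Kp : 0 < K%:R :> R by rewrite ltr0n.
have hNp : 0 < h%:R * N%:R ^+ 2 :> R by rewrite mulr_gt0// exprn_gt0.
pose lam : R := (h%:R * N%:R ^+ 2)^-1.
have lam0 : 0 < lam by rewrite invr_gt0.
pose x' p k := N%:R * x p k - o k.
pose y' q k := N%:R * y q k - o' k.
pose al p := x1 p + \sum_k (x' p k ^+ 2 + 2 * (o k - o' k) * x' p k) * (lam / 2).
pose be q := - y1 q - h%:R +
  \sum_k ((o k - o' k) ^+ 2 + y' q k ^+ 2 - 2 * (o k - o' k) * y' q k) * (lam / 2).
have := CP m K I J ci cj x' y' al be lam ciI cjI m0 K0 lam0 xP yP.
rewrite sqrtrV ?(ltW hNp)//; apply: le_trans.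
rewrite ler_nat; apply: subset_leq_card. apply/fintype.subsetP => z zS; rewrite inE.
have [h1 h2 h3 h4 [w hw]] := SP z zS.
set V := \sum_k (x z.1 k - y z.2 k) ^+ 2 in h3 h4.
have V0 : 0 <= V by apply: sumr_ge0 => k _; exact: sqr_ge0.
have nr : near_int (T%:R / K%:R) (r z - h%:R).
  exists (w - h%:Z); rewrite intrB -[(h%:Z)%:~R]/(h%:R).
  by have -> : r z - h%:R - (w%:~R - h%:R) = r z - w%:~R by ring.
have h3' : r z ^+ 2 = (h%:R + (x1 z.1 - y1 z.2 - h%:R)) ^+ 2 + V.
  by rewrite h3; congr (_ ^+ 2 + _); ring.
have h1' : 1 <= h%:R :> R by rewrite ler1n.
have [w' hw'] := near_int_phase_le Kp h1' a0 V0 h1 h2 h3' Kh h4 nr.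
apply/asboolP; exists w'; apply: le_trans (_ : (T%:R + 67 * a) / K%:R <= _); last first.
  by rewrite ler_pM2r ?invr_gt0.
apply: le_trans hw'; rewrite le_eqVlt; apply/orP; left; apply/eqP.
congr (`|_ - _|); rewrite /al /be.
have -> : V / (2 * h%:R) = \sum_k (x' z.1 k ^+ 2 + 2 * (o k - o' k) * x' z.1 k) * (lam / 2)
   + \sum_k ((o k - o' k) ^+ 2 + y' z.2 k ^+ 2 - 2 * (o k - o' k) * y' z.2 k) * (lam / 2)
   - lam * \sum_k x' z.1 k * y' z.2 k.
  rewrite /V mulr_suml mulr_sumr -sumrN -!big_split /=; apply: eq_bigr => k _.
  by rewrite /x' /y' /lam; field; rewrite !gt_eqF.
by ring.
Qed.

End CellPairs.

(** * Pairs with difference close to a fixed axis *)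

Section FixedAxis.
Variable R : realType.

(** The bound of [cell_pair_count] times K / m^D, for boxes of side m = O(h/Q). The
    relation Q^4 = K s balances the three terms: the first is (h/Q)^D, the second
    carries the factor K (K/s)^(D/2), assumed to be bounded, and the third
    sqrt K (Q / sqrt s)^D, which is the square root of that same factor. *)
Lemma slab_pair_total_le (D : nat) (N a s Q K m h B : R) :
  1 <= N -> 1 <= a -> 1 <= s -> 1 <= Q -> 1 <= K -> 0 < m -> 1 <= h -> 0 <= B ->
  Q ^+ 4 = K * s -> K * Num.sqrt (K / s) ^+ D <= a ->
  h <= a * s -> m <= B * h / Q ->
  m ^+ D * (1 + K * Num.sqrt (K / (h * N ^+ 2)) ^+ D
     + Num.sqrt K / (m / Num.sqrt (h * N ^+ 2)) ^+ D)
  <= ((B * a) ^+ D * (1 + a) + (N * a) ^+ D * a) * (s / Q) ^+ D.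
Proof.
move=> N1 a1 s1 Q1 K1 m0 h1 B0 QE Ka hs mB.
have N0 : 0 < N by lra.
have a0 : 0 < a by lra.
have s0 : 0 < s by lra.
have Q0 : 0 < Q by lra.
have K0 : 0 < K by lra.
have h0 : 0 < h by lra.
have sa : Num.sqrt a <= a.
  rewrite -[leRHS]ger0_norm ?(ltW a0)// -sqrtr_sqr ler_wsqrtr//; nra.
have hN : 0 < h * N ^+ 2 by rewrite mulr_gt0// exprn_gt0.
have shN : Num.sqrt (h * N ^+ 2) = N * Num.sqrt h.
  by rewrite sqrtrM ?(ltW h0)// sqrtr_sqr ger0_norm ?(ltW N0)// mulrC.
have sh0 : 0 < Num.sqrt h by rewrite sqrtr_gt0.
have ss0 : 0 < Num.sqrt s by rewrite sqrtr_gt0.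
have sK0 : 0 < Num.sqrt K by rewrite sqrtr_gt0.
have shs : Num.sqrt h <= a * Num.sqrt s.
  apply: le_trans (ler_wsqrtr hs) _.
  by rewrite sqrtrM ?(ltW a0)// ler_pM2r.
have sq (x : R) : 0 < x -> x = Num.sqrt x ^+ 2 by move=> x0; rewrite sqr_sqrtr// ltW.
have t1 : m ^+ D <= (B * a) ^+ D * (s / Q) ^+ D.
  rewrite -exprMn lerXn2r ?nnegrE ?(ltW m0)//.
    by rewrite !mulr_ge0// ?invr_ge0 ltW.
  apply: le_trans mB _; rewrite -!mulrA ler_wpM2l// [a * _]mulrA.
  by rewrite ler_pM2r ?invr_gt0.
have t2 : m ^+ D * (K * Num.sqrt (K / (h * N ^+ 2)) ^+ D)
    <= (B * a) ^+ D * a * (s / Q) ^+ D.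
  rewrite mulrCA -exprMn.
  apply: (@le_trans _ _ (K * ((B * a) * (s / Q) * Num.sqrt (K / s)) ^+ D)).
    rewrite ler_pM2l// lerXn2r ?nnegrE//.
    - by rewrite mulr_ge0 ?sqrtr_ge0 ?ltW.
    - by rewrite !mulr_ge0 ?sqrtr_ge0 ?invr_ge0 ?(ltW a0) ?(ltW s0) ?(ltW Q0).
    rewrite !sqrtrM ?(ltW K0)// !sqrtrV ?(ltW hN) ?(ltW s0)// shN.
    have e1 : m * (Num.sqrt K / (N * Num.sqrt h)) <= B * h / Q * (Num.sqrt K / Num.sqrt h).
      apply: ler_pM => //; rewrite ?(ltW m0)//.
        by rewrite divr_ge0 ?sqrtr_ge0// mulr_ge0 ?sqrtr_ge0// ltW.
      rewrite ler_pM2l// lef_pV2 ?posrE ?mulr_gt0//.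
      by rewrite ler_peMl// ltW.
    apply: le_trans e1 _; rewrite {1}(sq h h0) {1}(sq s s0).
    have -> : B * Num.sqrt h ^+ 2 / Q * (Num.sqrt K / Num.sqrt h) =
       (B * Num.sqrt K / Q) * Num.sqrt h by field; rewrite !gt_eqF.
    have -> : B * a * (Num.sqrt s ^+ 2 / Q) * (Num.sqrt K / Num.sqrt s) =
       (B * Num.sqrt K / Q) * (a * Num.sqrt s) by field; rewrite !gt_eqF.
    by rewrite ler_wpM2l// !mulr_ge0 ?invr_ge0 ?(ltW Q0)// ltW.
  rewrite [(_ * Num.sqrt _) ^+ D]exprMn [(B * a * _) ^+ D]exprMn.
  have p : 0 <= (B * a) ^+ D * (s / Q) ^+ D.
    by rewrite mulr_ge0// exprn_ge0// ?divr_ge0 ?mulr_ge0 ?(ltW a0) ?(ltW s0) ?(ltW Q0).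
  by have := ler_wpM2l p Ka; lra.
have t3 : m ^+ D * (Num.sqrt K / (m / Num.sqrt (h * N ^+ 2)) ^+ D)
    <= (N * a) ^+ D * a * (s / Q) ^+ D.
  have -> : m ^+ D * (Num.sqrt K / (m / Num.sqrt (h * N ^+ 2)) ^+ D) =
     Num.sqrt K * (N * Num.sqrt h) ^+ D.
    rewrite shN expr_div_n; have := exprn_gt0 D m0.
    have : 0 < (N * Num.sqrt h) ^+ D by rewrite exprn_gt0// mulr_gt0.
    move: (_ ^+ D) (_ ^+ D) => u v u0 v0; field; by rewrite !gt_eqF.
  apply: (@le_trans _ _ (Num.sqrt K * (N * a * (s / Q) * (Q / Num.sqrt s)) ^+ D)).
    rewrite ler_pM2l// lerXn2r ?nnegrE//.
    - by rewrite mulr_ge0// ltW.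
    - by rewrite !mulr_ge0// ?invr_ge0 ltW.
    rewrite {1}(sq s s0).
    have -> : N * a * (Num.sqrt s ^+ 2 / Q) * (Q / Num.sqrt s) = N * (a * Num.sqrt s).
      by field; rewrite !gt_eqF.
    by rewrite ler_pM2l.
  rewrite [(_ * (Q / _)) ^+ D]exprMn [(N * a * _) ^+ D]exprMn.
  have key : Num.sqrt K * (Q / Num.sqrt s) ^+ D <= a.
    apply: le_trans sa; rewrite -(@ler_pXn2r _ 2)// ?nnegrE ?sqrtr_ge0//; last first.
      by rewrite mulr_ge0 ?sqrtr_ge0 ?exprn_ge0// divr_ge0 ?sqrtr_ge0// ltW.
    rewrite exprMn !sqr_sqrtr ?(ltW K0) ?(ltW a0)//.
    apply: le_trans Ka; rewrite ler_pM2l// -exprM mulnC exprM.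
    rewrite lerXn2r ?nnegrE ?sqr_ge0 ?sqrtr_ge0//.
    rewrite expr_div_n sqr_sqrtr ?(ltW s0)//.
    have -> : Q ^+ 2 / s = Num.sqrt ((Q ^+ 2 / s) ^+ 2).
      by rewrite sqrtr_sqr ger0_norm// divr_ge0 ?sqr_ge0// ltW.
    rewrite ler_wsqrtr// expr_div_n -exprM QE le_eqVlt; apply/orP; left; apply/eqP.
    by field; rewrite gt_eqF.
  have p : 0 <= (N * a) ^+ D * (s / Q) ^+ D.
    by rewrite mulr_ge0// exprn_ge0// ?divr_ge0 ?mulr_ge0 ?(ltW a0) ?(ltW N0) ?(ltW s0) ?(ltW Q0).
  by have := ler_wpM2l p key; lra.
move: t1 t2 t3; move: (m ^+ D) (K * _ ^+ D) (Num.sqrt K / _) => A E F.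
by move: (_ ^+ D) (_ ^+ D) (_ ^+ D) => P W Z; lra.
Qed.

(** Pairs whose difference makes an angle O(1/Q) with the first axis. Cut space into slabs
    of thickness 1/N orthogonal to the axis, and for two slabs at distance about h cut
    both into boxes of side O(h/Q). A pair in question lies in two boxes whose
    transversal positions differ by at most one box in each coordinate. There are
    O(s^2) pairs of slabs, and each contributes O(s^D (s/Q)^D / K) by
    [cell_pair_count] and [slab_pair_total_le].

    Within two such boxes V = O((h/Q)^2), and Q^4 = K s is what keeps V^2 K = O(h^3). *)
Lemma axis_pairs_count (D T N : nat) (A a : R) : (0 < D)%N -> (0 < N)%N ->
  1 <= A -> 1 <= a -> exists2 C : R, 0 <= C &
  forall (I : finType) (X : I -> 'I_D.+1 -> R) (s Q : R) (K M : nat)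
    (r : I * I -> R) (S : {set I * I}),
  (forall p p', (forall k, Num.truncn (N%:R * X p k) = Num.truncn (N%:R * X p' k)) ->
     p = p') ->
  (forall p k, 0 <= X p k) -> (forall p k, N%:R * X p k < M%:R) ->
  M%:R <= a * s -> (0 < K)%N -> 1 <= s -> 1 <= Q -> Q ^+ 4 = K%:R * s ->
  K%:R * Num.sqrt (K%:R / s) ^+ D <= a ->
  (forall z, z \in S ->
    let v := X z.1 ord0 - X z.2 ord0 in
    let V := \sum_k (X z.1 (lift ord0 k) - X z.2 (lift ord0 k)) ^+ 2 in
    [/\ 4 <= v, Q <= v, K%:R <= a * v, V <= (A / Q) ^+ 2 * v ^+ 2 &
     [/\ 0 <= r z, r z ^+ 2 = v ^+ 2 + V & near_int (T%:R / K%:R) (r z)]]) ->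
  #|S|%:R <= C * (s ^+ (2 * D.+1) / (K%:R * Q ^+ D)).
Proof.
move=> D0 N0 A1 a1.
pose a' := 8 * A ^+ 4 * a; pose B := (A + 2) * (2 * N%:R).
have Np : 0 < N%:R :> R by rewrite ltr0n.
have N1 : 1 <= N%:R :> R by rewrite ler1n.
have Ap : 0 < A by lra.
have ap : 0 < a by lra.
have a'0 : 0 <= a' by rewrite /a' !mulr_ge0 ?exprn_ge0// ltW.
have B0 : 0 <= B by rewrite /B !mulr_ge0//; lra.
have [C1 C10 C1P] := @cell_pair_count R D T N a' D0 N0 a'0.
pose C2 := (B * a) ^+ D * (1 + a) + (N%:R * a) ^+ D * a.
have C20 : 0 <= C2.
  have e1 : 0 <= 1 + a by lra.
  have e2 : 0 <= B * a by rewrite mulr_ge0 // ltW.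
  have e3 : 0 <= N%:R * a by rewrite mulr_ge0 // ltW.
  by rewrite /C2 addr_ge0// mulr_ge0 ?exprn_ge0// ltW.
have A3 : 0 <= (A + 3) * a by rewrite mulr_ge0//; lra.
exists (a ^+ 2 * (3 ^+ D * C1 * ((A + 3) * a) ^+ D * C2)).
  by rewrite !mulr_ge0 ?exprn_ge0// ltW.
move=> I X s Q K M r S XI X0 XM Ms K0 s1 Q1 QE Ks SP.
have Kp : 0 < K%:R :> R by rewrite ltr0n.
have K1 : 1 <= K%:R :> R by rewrite ler1n.
have sp : 0 < s by lra.
have Qp : 0 < Q by lra.
have sQ : 0 <= s / Q by rewrite divr_ge0// ltW.
pose cell p k := Num.truncn (N%:R * X p k).
have cellP p k : (cell p k)%:R <= N%:R * X p k < (cell p k)%:R + 1.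
  by rewrite natr1; apply: truncn_itv; rewrite mulr_ge0.
have cellM p k : (cell p k < M)%N.
  by have /andP[h _] := cellP p k; rewrite -(ltr_nat R); apply: le_lt_trans h _.
have cell_inj p p' : (forall k, cell p k = cell p' k) -> p = p' by exact: XI.
pose Sij (ij : 'I_M * 'I_M) := [set z in S | (cell z.1 ord0 == ij.1 :> nat) &&
    (cell z.2 ord0 == ij.2 :> nat)].
pose E := 3 ^+ D * C1 * ((A + 3) * a) ^+ D * C2 * (s ^+ D * (s / Q) ^+ D / K%:R).
have E0 : 0 <= E.
  by rewrite /E !mulr_ge0 ?exprn_ge0 ?invr_ge0// ltW.
have slab ij : #|Sij ij|%:R <= E.
  have [->|[z0 z0S]] := set_0Vmem (Sij ij); first by rewrite cards0.
  pose l := (ij.1 - ij.2)%N; pose h := (l %/ N)%N.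
  (* The side of the boxes, in cells: more than the transversal distance in cells
     plus one, so that the two boxes coincide or are neighbours. *)
  pose m := (Num.truncn (A * l.+1%:R / Q)).+2.
  have At0 : 0 <= A * l.+1%:R / Q by rewrite divr_ge0 ?mulr_ge0// ltW.
  have /andP[m1 m2] := truncn_itv At0.
  have mE0 : m%:R = (Num.truncn (A * l.+1%:R / Q))%:R + 2 :> R.
    by rewrite /m -addn2 natrD.
  have m3 : A * l.+1%:R / Q < m%:R - 1.
    by move: m2; rewrite mE0 -[(Num.truncn _).+1%:R]natr1; clear; lra.
  have hl1 : (h * N)%:R <= l%:R :> R by rewrite ler_nat leq_divM.
  have hl2 : l.+1%:R <= (h%:R + 1) * N%:R :> R.
    by rewrite natr1 -natrM ler_nat ltn_ceil.
  have vP z : z \in Sij ij -> 4 <= X z.1 ord0 - X z.2 ord0 ->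
      (l%:R - 1 < N%:R * (X z.1 ord0 - X z.2 ord0) < l.+1%:R).
    rewrite inE => /and3P[_ /eqP e1 /eqP e2] v4.
    have := cellP z.1 ord0; have := cellP z.2 ord0; rewrite e1 e2.
    move=> /andP[f1 f2] /andP[f3 f4].
    have f5 : 4 <= N%:R * (X z.1 ord0 - X z.2 ord0).
      have vv : 0 <= X z.1 ord0 - X z.2 ord0 by exact: le_trans v4.
      by apply: le_trans v4 _; exact: ler_peMl.
    have f6 : (ij.2 <= ij.1)%N by rewrite -(ler_nat R); move: f1 f4 f5; clear; lra.
    move: f1 f2 f3 f4; rewrite /l -natr1 natrB//; clear; move=> f1 f2 f3 f4; apply/andP; split; lra.
  have z0S' : z0 \in S by move: z0S; rewrite inE => /andP[].
  have [v4 vQ vK _ _] := SP z0 z0S'.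
  have /andP[v1 v2] := vP z0 z0S v4.
  set v := X z0.1 ord0 - X z0.2 ord0 in v4 vQ vK v1 v2.
  have vh : v < h%:R + 1.
    have := lt_le_trans v2 hl2; rewrite [N%:R * v]mulrC ltr_pM2r//.
  have h3 : 3 < h%:R :> R by move: vh v4; clear; lra.
  have h0 : (0 < h)%N by rewrite -(ltr_nat R); exact: lt_trans h3.
  have v2h : v <= 2 * h%:R by move: vh h3; clear; lra.
  have NM : N%:R * h%:R <= a * s.
    apply: le_trans Ms; rewrite -natrM ler_nat mulnC.
    apply: leq_trans (leq_divM _ _) _.
    exact: leq_trans (leq_subr _ _) (ltnW (ltn_ord _)).
  have has : h%:R <= a * s by apply: le_trans NM; exact: ler_peMl.
  have lN : l.+1%:R <= 2 * N%:R * h%:R :> R.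
    by apply: le_trans hl2 _; have := ler_wpM2r (ltW Np) (ltW h3); move: Np; clear; lra.
  have Nv : Q <= l.+1%:R.
    by apply: le_trans vQ _; apply: le_trans (ltW v2); apply: ler_peMl => //; lra.
  have mE : m%:R <= (A + 2) * l.+1%:R / Q.
    have e1 : 1 <= l.+1%:R / Q by rewrite ler_pdivlMr// mul1r.
    rewrite mE0 [(A + 2) * _]mulrDl [leRHS]mulrDl -mulrA; move: m1 e1; rewrite -mulrA; clear; lra.
  have mB : m%:R <= B * h%:R / Q.
    apply: le_trans mE _; rewrite ler_pM2r ?invr_gt0// /B -mulrA ler_pM2l//; move: A1; clear; lra.
  have m0 : (0 < m)%N by [].
  have mM : m%:R <= (A + 2) * (a * s).
    have e1 : l.+1%:R <= a * s.
      apply: le_trans Ms; rewrite ler_nat.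
      exact: leq_ltn_trans (leq_subr _ _) (ltn_ord _).
    apply: le_trans mE _; rewrite ler_pdivrMr// -mulrA ler_pM2l; last by move: A1; clear; lra.
    apply: le_trans e1 _; apply: ler_peMr => //; exact: mulr_ge0 (ltW ap) (ltW sp).
  pose b := (M %/ m).+1.
  pose box p k := (cell p (lift ord0 k) %/ m)%N.
  have boxb p k : (box p k < b)%N.
    by rewrite /b ltnS; apply: leq_div2r; apply: ltnW; exact: cellM.
  (* The position of the first box, and the position of the second one relative
     to it, shifted by 1. *)
  pose idx := ({ffun 'I_D -> 'I_b} * {ffun 'I_D -> 'I_3})%type.
  pose inI (w : idx) p := (cell p ord0 == ij.1 :> nat) &&
     [forall k, box p k == w.1 k].
  pose inJ (w : idx) q := (cell q ord0 == ij.2 :> nat) &&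
     [forall k, (box q k).+1 == w.1 k + w.2 k]%N.
  pose Sw (w : idx) := [set z in S | inI w z.1 && inJ w z.2].
  have cov : (#|Sij ij| <= \sum_w #|Sw w|)%N.
    apply: card_cover_le => z zS.
    have zS' : z \in S by move: zS; rewrite inE => /andP[].
    have [w4 wQ wK wV _] := SP z zS'.
    have /andP[w1 w2] := vP z zS w4.
    set vz := X z.1 ord0 - X z.2 ord0 in w4 wQ wK wV w1 w2.
    have cd k : `|N%:R * (X z.1 (lift ord0 k) - X z.2 (lift ord0 k))| <= A * l.+1%:R / Q.
      have e1 : (X z.1 (lift ord0 k) - X z.2 (lift ord0 k)) ^+ 2 <= (A / Q * vz) ^+ 2.
        rewrite exprMn; apply: le_trans wV.
        by rewrite (bigD1 k)//= lerDl; apply: sumr_ge0 => i _; exact: sqr_ge0.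
      have AQ0 : 0 <= A / Q by rewrite divr_ge0// ltW.
      have e2 : `|X z.1 (lift ord0 k) - X z.2 (lift ord0 k)| <= A / Q * vz.
        rewrite -(@ler_pXn2r _ 2)// ?nnegrE ?real_normK ?num_real//.
        by rewrite mulr_ge0//; exact: le_trans w4.
      rewrite normrM normr_nat mulrAC.
      have e3 := ler_wpM2l (ltW Np) e2; apply: le_trans e3 _.
      by rewrite mulrCA ler_wpM2l// ltW.
    have bd k : (box z.1 k <= (box z.2 k).+1 /\ box z.2 k <= (box z.1 k).+1)%N.
      have /andP[c1 c2] := cellP z.1 (lift ord0 k).
      have /andP[c3 c4] := cellP z.2 (lift ord0 k).
      have := cd k; rewrite ler_norml mulrBr => /andP[c5 c6].
      have c7 : (cell z.1 (lift ord0 k) <= cell z.2 (lift ord0 k) + m)%N.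
        rewrite -ltnS -(ltr_nat R) -natr1 natrD.
        by move: m3 c1 c2 c3 c4 c5 c6; clear; lra.
      have c8 : (cell z.2 (lift ord0 k) <= cell z.1 (lift ord0 k) + m)%N.
        rewrite -ltnS -(ltr_nat R) -natr1 natrD.
        by move: m3 c1 c2 c3 c4 c5 c6; clear; lra.
      have mm x : ((x + m) %/ m = (x %/ m).+1)%N by rewrite divnDr// divnn addn1.
      by rewrite /box -!mm; split; apply: leq_div2r.
    have ebd k : ((box z.2 k).+1 - box z.1 k < 3)%N.
      by have [_] := bd k; move: (box z.2 k) (box z.1 k); clear; lia.
    exists ([ffun k => Ordinal (boxb z.1 k)], [ffun k => Ordinal (ebd k)]).
    move: zS; rewrite !inE /inI /inJ => /and3P[-> -> ->] /=.
    apply/andP; split; apply/forallP => k; rewrite !ffunE //=.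
    by have [? _] := bd k; rewrite subnKC.
  have one w : #|Sw w|%:R <= C1 * (m%:R ^+ (2 * D) / K%:R *
       (1 + K%:R * Num.sqrt (K%:R / (h%:R * N%:R ^+ 2)) ^+ D
       + Num.sqrt K%:R / (m%:R / Num.sqrt (h%:R * N%:R ^+ 2)) ^+ D)).
    pose I' := {p : I | inI w p}; pose J' := {q : I | inJ w q}.
    pose co p : {ffun 'I_D -> 'I_m} := [ffun k => inord (cell p (lift ord0 k) %% m)].
    have coE p k : (co p k = cell p (lift ord0 k) %% m :> nat)%N.
      by rewrite ffunE inordK// ltn_pmod.
    have coI p p' : cell p ord0 = cell p' ord0 -> (forall k, box p k = box p' k) ->
        co p = co p' -> p = p'.
      move=> e1 e2 e3; apply: cell_inj => k.
      case: (unliftP ord0 k) => [k'|] -> //.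
      rewrite (divn_eq (cell p _) m) (divn_eq (cell p' _) m) -!coE e3.
      by have := e2 k'; rewrite /box => ->.
    pose S' : {set I' * J'} := [set z | (val z.1, val z.2) \in S].
    have SS' : (#|Sw w| <= #|S'|)%N.
      pose f (z : I' * J') := (val z.1, val z.2).
      have sub : Sw w \subset f @: S'.
        apply/fintype.subsetP => -[p q]; rewrite inE /= => /and3P[e1 e2 e3].
        apply/imsetP; exists (exist _ p e2, exist _ q e3) => //.
        by rewrite inE.
      by apply: leq_trans (subset_leq_card sub) (leq_imset_card _ _).
    apply: le_trans (_ : #|S'|%:R <= _); first by rewrite ler_nat.
    apply: (C1P m K h I' J' (fun p => co (val p)) (fun q => co (val q))
      (fun k => (w.1 k * m)%:R) (fun k => ((w.1 k + w.2 k).-1 * m)%:R)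
      (fun p k => X (val p) (lift ord0 k)) (fun q k => X (val q) (lift ord0 k))
      (fun p => X (val p) ord0) (fun q => X (val q) ord0)
      (fun z => r (val z.1, val z.2)) S') => //.
    - move=> p p' e; apply: val_inj; apply: coI e.
        have /andP[/eqP-> _] := valP p; by have /andP[/eqP-> _] := valP p'.
      move=> k; have /andP[_ /forallP/(_ k)/eqP->] := valP p.
      by have /andP[_ /forallP/(_ k)/eqP->] := valP p'.
    - move=> p p' e; apply: val_inj; apply: coI e.
        have /andP[/eqP-> _] := valP p; by have /andP[/eqP-> _] := valP p'.
      move=> k; apply: succn_inj; have /andP[_ /forallP/(_ k)/eqP->] := valP p.
      by have /andP[_ /forallP/(_ k)/eqP->] := valP p'.
    - move=> p k; rewrite coE; have /andP[_ /forallP/(_ k)/eqP e] := valP p.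
      have := cellP (val p) (lift ord0 k).
      rewrite {1 2}(divn_eq (cell (val p) (lift ord0 k)) m) -/(box _ _) e natrD.
      by clear; move=> /andP[e1 e2]; apply/andP; split; lra.
    - move=> p k; rewrite coE; have /andP[_ /forallP/(_ k)/eqP e] := valP p.
      have := cellP (val p) (lift ord0 k).
      rewrite {1 2}(divn_eq (cell (val p) (lift ord0 k)) m) -/(box _ _) -e natrD /=.
      by clear; move=> /andP[e1 e2]; apply/andP; split; lra.
    - apply: le_trans vK _; rewrite /a'.
      have A4 : 1 <= A ^+ 4 by rewrite exprn_ege1.
      apply: (@le_trans _ _ (a * (2 * h%:R))); first by rewrite ler_pM2l.
      have : 0 <= a * h%:R by rewrite mulr_ge0// ltW.
      by move=> e; have := ler_wpM2r e A4; move: e; clear; lra.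
    move=> [p q]; rewrite inE /= => zS.
    have zS2 : (val p, val q) \in Sij ij.
      rewrite inE zS /=; have /andP[-> _] := valP p; by have /andP[-> _] := valP q.
    have [w4 wQ wK wV [r0 rE rn]] := SP _ zS.
    have /andP[w1 w2] := vP _ zS2 w4.
    move: w4 wQ wK wV r0 rE rn w1 w2 => /=.
    set vz := X (val p) ord0 - X (val q) ord0.
    set V := \sum_k _ => w4 wQ wK wV r0 rE rn w1 w2.
    have vzh : vz < h%:R + 1.
      have := lt_le_trans w2 hl2; rewrite [N%:R * vz]mulrC ltr_pM2r//.
    have vzh2 : h%:R - 1 <= vz.
      rewrite -(ler_pM2l Np); apply: le_trans (ltW w1).
      by move: hl1 N1; rewrite natrM; clear; lra.
    split=> //.
      by rewrite ler_norml; move: vzh vzh2; clear; move=> ? ?; apply/andP; split; lra.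
    have V0 : 0 <= V by apply: sumr_ge0 => k _; exact: sqr_ge0.
    have vzs : vz <= a * s.
      apply: le_trans Ms; apply: le_trans (ltW (XM (val p) ord0)).
      have := X0 (val q) ord0; have := X0 (val p) ord0.
      move=> e1 e2; have := ler_wpM2r e1 N1; move: e2.
      rewrite /vz; clear; lra.
    have vz0 : 0 < vz by exact: lt_le_trans w4.
    have e1 : V ^+ 2 <= (A / Q) ^+ 4 * vz ^+ 4.
      have -> : (A / Q) ^+ 4 * vz ^+ 4 = ((A / Q) ^+ 2 * vz ^+ 2) ^+ 2 by ring.
      by rewrite ler_pXn2r ?nnegrE// mulr_ge0 ?sqr_ge0.
    apply: le_trans (ler_wpM2r (ltW Kp) e1) _.
    have -> : (A / Q) ^+ 4 * vz ^+ 4 * K%:R = A ^+ 4 * vz ^+ 3 * (vz / s).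
      rewrite expr_div_n QE; field; by rewrite !gt_eqF.
    have e2 : vz / s <= a by rewrite ler_pdivrMr.
    have e3 : vz ^+ 3 <= 8 * h%:R ^+ 3.
      have -> : 8 * h%:R ^+ 3 = (2 * h%:R) ^+ 3 :> R by ring.
      rewrite lerXn2r ?nnegrE ?mulr_ge0 ?(ltW vz0)//; move: vzh h3; clear; lra.
    have A4 : 0 <= A ^+ 4 by rewrite exprn_ge0// ltW.
    apply: (@le_trans _ _ (A ^+ 4 * (8 * h%:R ^+ 3) * a)); last by rewrite /a'; clear; lra.
    apply: ler_pM => //.
    - by rewrite mulr_ge0// exprn_ge0// ltW.
    - by rewrite divr_ge0// ltW.
    - by rewrite ler_wpM2l.
  apply: (@le_trans _ _ (\sum_(w : idx) #|Sw w|%:R)); first by rewrite -natr_sum ler_nat.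
  apply: le_trans (ler_sum _ (fun w _ => one w)) _.
  rewrite sumr_const -[_ *+ _]mulr_natl /idx card_prod !card_ffun !card_ord.
  have m0R : 0 < m%:R :> R by rewrite ltr0n.
  have h1 : 1 <= h%:R :> R by rewrite ler1n.
  have := slab_pair_total_le N1 a1 s1 Q1 K1 m0R h1 B0 QE Ks has mB.
  rewrite -/C2; set Z := 1 + _ + _ => hZ.
  have bm : b%:R * m%:R <= (A + 3) * a * s.
    rewrite /b -natr1 mulrDl mul1r.
    have : (M %/ m)%:R * m%:R <= M%:R :> R by rewrite -natrM ler_nat leq_divM.
    by move: mM Ms; clear; lra.
  have bmD : (b%:R * m%:R) ^+ D <= ((A + 3) * a) ^+ D * s ^+ D.
    rewrite -exprMn; apply: lerXn2r => //; rewrite nnegrE; apply: mulr_ge0 => //; exact: ltW.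
  have -> : (b ^ D * 3 ^ D)%:R * (C1 * (m%:R ^+ (2 * D) / K%:R * Z)) =
     3 ^+ D * C1 / K%:R * ((b%:R * m%:R) ^+ D * (m%:R ^+ D * Z)).
    rewrite natrM !natrX mul2n -addnn exprD exprMn.
    by move: (_ ^+ D) (_ ^+ D) (_ ^+ D) => u1 u2 u3; field; rewrite gt_eqF.
  have -> : E = 3 ^+ D * C1 / K%:R * ((((A + 3) * a) ^+ D * s ^+ D) * (C2 * (s / Q) ^+ D)).
    rewrite /E; move: (_ ^+ D) (_ ^+ D) (_ ^+ D) (_ ^+ D) => u1 u2 u3 u4.
    by field; rewrite gt_eqF.
  rewrite ler_wpM2l//; first by rewrite !mulr_ge0 ?exprn_ge0 ?invr_ge0// ltW.
  apply: ler_pM => //.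
  have Z0 : 0 <= Z.
    rewrite /Z; apply: addr_ge0; first apply: addr_ge0 => //.
      by apply: mulr_ge0 => //; apply: exprn_ge0; exact: sqrtr_ge0.
  by apply: mulr_ge0 => //; exact: exprn_ge0.
have cov : (#|S| <= \sum_ij #|Sij ij|)%N.
  apply: card_cover_le => z zS.
  by exists (Ordinal (cellM z.1 ord0), Ordinal (cellM z.2 ord0)); rewrite inE zS /= !eqxx.
apply: (@le_trans _ _ (\sum_ij #|Sij ij|%:R)); first by rewrite -natr_sum ler_nat.
apply: le_trans (ler_sum _ (fun ij _ => slab ij)) _.
rewrite sumr_const -[_ *+ _]mulr_natl card_prod !card_ord natrM.
apply: (@le_trans _ _ ((a * s) * (a * s) * E)).
  by rewrite ler_wpM2r// ler_pM.
rewrite le_eqVlt; apply/orP; left; apply/eqP; rewrite /E expr_div_n.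
rewrite mulnS exprD mul2n -addnn exprD.
have : 0 < Q ^+ D by exact: exprn_gt0.
move: (_ ^+ D) (_ ^+ D) (_ ^+ D) (_ ^+ D) => u1 u2 u3 u4 u40.
by field; rewrite !gt_eqF.
Qed.

End FixedAxis.

(** * Reflections and a net of directions *)

Local Notation net_index D P :=
  ('I_D.+1 * bool * {ffun 'I_D -> 'I_(2 * P).+1})%type.

Section Directions.
Variable R : realType.

Lemma same_cell_dist_lt (D N : nat) (c : R) (x y : 'I_D.+1 -> R) :
  0 < c -> (0 < N)%N -> D.+1%:R / c ^+ 2 < N%:R ->
  (forall k, 0 <= x k) -> (forall k, 0 <= y k) ->
  (forall k, Num.truncn (N%:R * x k) = Num.truncn (N%:R * y k)) ->
  \sum_k (x k - y k) ^+ 2 < c ^+ 2.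
Proof.
move=> c0 N0 Nc x0 y0 H.
have c20 : 0 < c ^+ 2 by rewrite exprn_gt0.
have Np : 0 < N%:R :> R by rewrite ltr0n.
have N1 : 1 <= N%:R :> R by rewrite ler1n.
apply: (@le_lt_trans _ _ (D.+1%:R / N%:R)); last first.
  by rewrite ltr_pdivrMr// mulrC -ltr_pdivrMr.
have nn : N%:R^-1 ^+ 2 <= N%:R^-1 :> R.
  by rewrite expr2 ler_piMl ?invr_ge0// invf_le1.
apply: (@le_trans _ _ (D.+1%:R * N%:R^-1 ^+ 2)); last by rewrite ler_wpM2l.
rewrite mulr_natl -[D.+1 in leRHS]card_ord -sumr_const; apply: ler_sum => k _.
rewrite -real_normK ?num_real// lerXn2r ?nnegrE ?invr_ge0//.
rewrite -(ler_pM2l Np) divff ?gt_eqF// -{1}(gtr0_norm Np) -normrM mulrBr.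
have /andP[h1 h2] := truncn_itv (mulr_ge0 (ltW Np) (x0 k)).
have /andP[h3 h4] := truncn_itv (mulr_ge0 (ltW Np) (y0 k)).
rewrite H in h1 h2; rewrite -natr1 in h2; rewrite -natr1 in h4.
by rewrite ler_norml; move: h1 h2 h3 h4; clear => *; apply/andP; split; lra.
Qed.

(** The reflection that exchanges z / |z| and the first basis vector. If the two coincide
    then w = 0, and since division by zero yields zero the same formula is the
    identity. *)
Lemma exists_frame (D : nat) (z : 'I_D.+1 -> R) : 0 < \sum_k z k ^+ 2 ->
  exists L : ('I_D.+1 -> R) -> 'I_D.+1 -> R,
  [/\ forall x y k, L (fun j => x j - y j) k = L x k - L y k,
      forall x, \sum_k L x k ^+ 2 = \sum_k x k ^+ 2 &
      forall x, L x ord0 = (\sum_k x k * z k) / Num.sqrt (\sum_k z k ^+ 2)].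
Proof.
set n2 := \sum_k z k ^+ 2 => n20.
pose n := Num.sqrt n2; have n0 : 0 < n by rewrite sqrtr_gt0.
have nn : n ^+ 2 = n2 by rewrite sqr_sqrtr// ltW.
pose u k := z k / n - (k == ord0)%:R.
pose w := \sum_k u k ^+ 2.
pose dot x := \sum_k x k * u k : R.
pose L x k := x k - 2 * dot x / w * u k.
have dotB x y : dot (fun j => x j - y j) = dot x - dot y.
  by rewrite /dot -sumrB; apply: eq_bigr => k _; rewrite mulrBl.
have delta (f : 'I_D.+1 -> R) : \sum_k f k * (k == ord0)%:R = f ord0.
  rewrite (bigD1 ord0)//= mulr1 big1 ?addr0// => k /negbTE ->; exact: mulr0.
have wE : w = - 2 * u ord0.
  have e1 : w = \sum_k ((z k ^+ 2 / n2) + (- 2 * (z k / n) + 1) * (k == ord0)%:R).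
    apply: eq_bigr => k _; rewrite -nn /u; case: (k == ord0) => /=; field;
      by rewrite gt_eqF.
  rewrite e1 big_split /= -mulr_suml divff ?gt_eqF// delta /= /u eqxx mulr1n; ring.
exists L; split.
- by move=> x y k; rewrite /L dotB; ring.
- move=> x.
  have LE k : L x k = x k - 2 * (dot x / w) * u k by rewrite /L mulrA.
  have -> : \sum_k L x k ^+ 2 =
     \sum_k x k ^+ 2 - 4 * (dot x / w) * dot x + 4 * (dot x / w) ^+ 2 * w.
    move: (dot x / w) LE => c LE.
    rewrite /dot /w !mulr_sumr -sumrB -big_split /=.
    by apply: eq_bigr => k _; rewrite LE; ring.
  have [w0|w0] := eqVneq w 0; first by rewrite w0 invr0; ring.
  by field.
- move=> x; rewrite /L.
  have -> : 2 * dot x / w * u ord0 = - dot x.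
    have [w0|w0] := eqVneq w 0.
      have u0 k : u k = 0.
        have := w0; rewrite /w (bigD1 k)//= => /eqP.
        rewrite paddr_eq0 ?sqr_ge0//; last by apply: sumr_ge0 => j _; exact: sqr_ge0.
        by rewrite sqrf_eq0 => /andP[/eqP].
      by rewrite u0 mulr0 /dot big1 ?oppr0// => k _; rewrite u0 mulr0.
    have u0 : u ord0 != 0 by move: w0; rewrite wE mulf_eq0 negb_or => /andP[].
    by rewrite wE; field.
  rewrite opprK /dot.
  have -> : \sum_k x k * u k = \sum_k (x k * z k) / n - \sum_k x k * (k == ord0)%:R.
    by rewrite -sumrB; apply: eq_bigr => k _; rewrite /u; ring.
  by rewrite delta -mulr_suml addrC subrK.
Qed.

(** The integer points on the surface of the cube [-P,P]^(D+1): the index consists of a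
    coordinate and a sign, which choose a face, and of the other coordinates shifted
    by P. *)
Definition net_vector D P (w : net_index D P) (k : 'I_D.+1) : R :=
  if unlift w.1.1 k is Some j then (w.2 j)%:R - P%:R else (-1) ^+ w.1.2 * P%:R.

Lemma net_vector_sqr_ge D P (w : net_index D P) :
  P%:R ^+ 2 <= \sum_k net_vector w k ^+ 2.
Proof.
rewrite (bigD1 w.1.1)//= {1}/net_vector unlift_none exprMn sqrr_sign mul1r lerDl.
by apply: sumr_ge0 => k _; exact: sqr_ge0.
Qed.

(** Scale v so that its largest coordinate becomes P or -P, and round the others. The
    Gram determinant |v|^2 |z|^2 - (v.z)^2 does not change when a multiple of v is
    subtracted from z, so only the rounding error enters. *)
Lemma exists_net_vector D P (v : 'I_D.+1 -> R) : (D < P)%N ->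
  0 < \sum_k v k ^+ 2 -> exists w : net_index D P,
  let z := net_vector w in
  0 < \sum_k v k * z k /\
  (\sum_k v k ^+ 2) * (\sum_k z k ^+ 2) - (\sum_k v k * z k) ^+ 2
    <= (\sum_k v k ^+ 2) * D.+1%:R.
Proof.
move=> DP v0.
have [i ib] : exists i, forall k, `|v k| <= `|v i|.
  case: (@arg_maxP _ _ _ ord0 xpredT (fun k => `|v k|)) => // i _ h.
  by exists i => k; exact: h.
have vi0 : 0 < `|v i|.
  rewrite normr_gt0; apply: contraTneq v0 => vi; rewrite -leNgt big1// => k _.
  by have := ib k; rewrite vi normr0 normr_le0 => /eqP->; rewrite expr0n.
have Pp : 0 < P%:R :> R by rewrite ltr0n; apply: leq_ltn_trans DP.
pose t := P%:R / `|v i|.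
have t0 : 0 < t by rewrite divr_gt0.
have tv k : `|t * v k| <= P%:R.
  by rewrite normrM (gtr0_norm t0) /t mulrAC ler_pdivrMr// ler_pM2l.
have tv0 k : 0 <= t * v k + P%:R by have := tv k; rewrite ler_norml => /andP[]; lra.
have tvP k : (Num.truncn (t * v k + P%:R) < (2 * P).+1)%N.
  rewrite ltnS -(ler_nat R); have /andP[h _] := truncn_itv (tv0 k).
  apply: le_trans h _; rewrite natrM; have := tv k; rewrite ler_norml => /andP[]; lra.
pose w : net_index D P := (i, v i < 0, [ffun j => Ordinal (tvP (lift i j))]).
exists w => z.
have zi : z i = t * v i.
  rewrite /z /net_vector /= unlift_none /t.
  have -> : P%:R / `|v i| * v i = v i / `|v i| * P%:R by ring.
  congr (_ * _); case: (ltP (v i) 0) => h /=.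
    by rewrite ltr0_norm// invrN mulrN mulfV ?expr1// lt_eqF.
  by rewrite expr0 ger0_norm// mulfV// -normr_gt0.
have zk j : - 1 <= z (lift i j) - t * v (lift i j) <= 1.
  rewrite /z /net_vector /= liftK ffunE /=.
  by have /andP[h1 h2] := truncn_itv (tv0 (lift i j)); rewrite -natr1 in h2; apply/andP; split; lra.
have ek k : `|z k - t * v k| <= 1.
  case: (unliftP i k) => [j ->|->]; last by rewrite zi subrr normr0.
  by rewrite ler_norml zk.
split.
  rewrite (bigD1_ord i)//= zi.
  have h1 : v i * (t * v i) = P%:R * `|v i|.
    rewrite mulrCA -expr2 -[v i ^+ 2]real_normK ?num_real// /t; field.
    by rewrite gt_eqF.
  have h2 : - (D%:R * `|v i|) <= \sum_j v (lift i j) * z (lift i j).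
    rewrite -mulrN -[X in X%:R * _]card_ord mulr_natl -sumr_const.
    apply: ler_sum => j _.
    have -> : v (lift i j) * z (lift i j) = t * v (lift i j) ^+ 2 +
       v (lift i j) * (z (lift i j) - t * v (lift i j)) by ring.
    have e1 : 0 <= t * v (lift i j) ^+ 2 by rewrite mulr_ge0 ?sqr_ge0// ltW.
    have e2 : `|v (lift i j) * (z (lift i j) - t * v (lift i j))| <= `|v i|.
      by rewrite normrM -[leRHS]mulr1 ler_pM.
    by move: e2; rewrite ler_norml => /andP[]; lra.
  have : D%:R * `|v i| < P%:R * `|v i| by rewrite ltr_pM2r// ltr_nat.
  by rewrite h1; lra.
set V := \sum_k v k ^+ 2.
pose e k := z k - t * v k.
have E : V * (\sum_k z k ^+ 2) - (\sum_k v k * z k) ^+ 2 =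
    V * (\sum_k e k ^+ 2) - (\sum_k v k * e k) ^+ 2.
  have -> : \sum_k z k ^+ 2 = \sum_k e k ^+ 2 + 2 * t * (\sum_k v k * e k) + t ^+ 2 * V.
    by rewrite !mulr_sumr -!big_split /=; apply: eq_bigr => k _; rewrite /e; ring.
  have -> : \sum_k v k * z k = \sum_k v k * e k + t * V.
    by rewrite !mulr_sumr -!big_split /=; apply: eq_bigr => k _; rewrite /e; ring.
  by ring.
rewrite E; apply: (@le_trans _ _ (V * (\sum_k e k ^+ 2))).
  by rewrite gerBl sqr_ge0.
rewrite ler_wpM2l ?(ltW v0)// -[D.+1 in leRHS]card_ord -sumr_const.
apply: ler_sum => k _; rewrite -real_normK ?num_real// expr_le1//; exact: ek.
Qed.

End Directions.

(** * Distant pairs *)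

Section FarPairs.
Variable R : realType.

(** The squared component of a vector of square norm S orthogonal to the axis is
    S - v^2; by the hypothesis it is at most S (D+1) / n2, and n2 is at least
    4 (D+1) Q^2. *)
Lemma frame_components_le (D : nat) (n2 S dot r Q P : R) :
  1 <= Q -> 2 * D.+1%:R * Q <= P -> P ^+ 2 <= n2 -> 0 <= r -> r ^+ 2 = S ->
  0 < dot -> S * n2 - dot ^+ 2 <= S * D.+1%:R ->
  let v := dot / Num.sqrt n2 in
  r <= 2 * v /\ S - v ^+ 2 <= (1 / Q) ^+ 2 * v ^+ 2.
Proof.
move=> Q1 QP Pn r0 rS d0 H.
have Q0 : 0 < Q by lra.
have D1 : 1 <= D.+1%:R :> R by rewrite ler1n.
have P0 : 0 < P by apply: lt_le_trans QP; rewrite !mulr_gt0.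
have n0 : 0 < n2 by apply: lt_le_trans Pn; rewrite exprn_gt0.
set v := dot / _; have v0 : 0 < v by rewrite divr_gt0// sqrtr_gt0.
have vE : v ^+ 2 = dot ^+ 2 / n2 by rewrite expr_div_n sqr_sqrtr// ltW.
have S0 : 0 <= S by rewrite -rS sqr_ge0.
have h1 : (S - v ^+ 2) * n2 <= S * D.+1%:R.
  by apply: le_trans H; rewrite mulrBl vE divfK ?gt_eqF.
have h2 : 4 * D.+1%:R * Q ^+ 2 <= n2.
  apply: le_trans Pn; apply: (@le_trans _ _ ((2 * D.+1%:R * Q) ^+ 2)).
    rewrite !exprMn; have := sqr_ge0 Q => e.
    have e2 : D.+1%:R <= D.+1%:R ^+ 2 :> R by rewrite expr2 ler_peMl.
    by have := ler_wpM2r e e2; lra.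
  by rewrite lerXn2r ?nnegrE ?(ltW P0)// !mulr_ge0// ltW.
have h3 : (S - v ^+ 2) * (4 * Q ^+ 2) <= S.
  have [e|e] := leP (S - v ^+ 2) 0.
    by apply: le_trans S0; rewrite mulr_le0_ge0// mulr_ge0// sqr_ge0.
  rewrite -(ler_pM2r (_ : 0 < D.+1%:R)) ?ltr0n//; apply: le_trans h1.
  have := ler_wpM2l (ltW e) h2; clear; lra.
have Q2 : 1 <= Q ^+ 2 by rewrite exprn_ege1.
have h4 : S <= 4 * v ^+ 2.
  have [e|e] := leP (S - v ^+ 2) 0; first by have := sqr_ge0 v; lra.
  by have := ler_wpM2l (ltW e) Q2; lra.
split.
  have e : r ^+ 2 <= (2 * v) ^+ 2 by rewrite rS exprMn; lra.
  have v20 : 0 <= 2 * v by rewrite mulr_ge0// ltW.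
  by rewrite -(@ler_pXn2r _ 2)// nnegrE.
have -> : (1 / Q) ^+ 2 * v ^+ 2 = v ^+ 2 / Q ^+ 2 by field; rewrite gt_eqF.
rewrite ler_pdivlMr ?exprn_gt0//.
by move: h3 h4; clear; lra.
Qed.

(** There are O(Q^D) net vectors, and each direction is within O(1/Q) of one of them. After
    a reflection that takes the net vector to the first axis, and a translation that
    makes the coordinates nonnegative, [axis_pairs_count] applies; the powers of Q
    cancel. The unit cubes do not survive the reflection, but c-separation does,
    and it puts at most one point in each cell of side 1/N. *)
Lemma far_pairs_count (D T : nat) (c a : R) : (0 < D)%N -> 0 < c -> 1 <= a ->
  exists2 C : R, 0 <= C &
  forall (I : finType) (pos : I -> 'I_D.+1 -> R) (s Q : R) (K : nat)
    (S : {set I * I}),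
  (forall p p', p != p' -> c ^+ 2 <= \sum_k (pos p k - pos p' k) ^+ 2) ->
  (forall p k, 0 <= pos p k <= s) ->
  (0 < K)%N -> 1 <= s -> 1 <= Q -> Q ^+ 4 = K%:R * s ->
  K%:R * Num.sqrt (K%:R / s) ^+ D <= a ->
  (forall z, z \in S ->
    let r := Num.sqrt (\sum_k (pos z.1 k - pos z.2 k) ^+ 2) in
    [/\ 8 <= r, 2 * Q <= r, 2 * K%:R <= a * r & near_int (T%:R / K%:R) r]) ->
  #|S|%:R <= C * (s ^+ (2 * D.+1) / K%:R).
Proof.
move=> D0 c0 a1.
pose N := (Num.bound (D.+1%:R / c ^+ 2)).+1.
have c20 : 0 < c ^+ 2 by rewrite exprn_gt0.
have Nc : D.+1%:R / c ^+ 2 < N%:R.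
  apply: lt_trans (archi_boundP _) _; first by rewrite divr_ge0 ?sqr_ge0.
  by rewrite ltr_nat.
have Np : 0 < N%:R :> R by rewrite ltr0n.
have N1 : 1 <= N%:R :> R by rewrite ler1n.
pose b := 2 * N%:R * D.+1%:R + 1 : R.
have b0 : 0 <= b by rewrite addr_ge0// !mulr_ge0.
have a2 : 1 <= a + b by lra.
have [C C0 CP] := @axis_pairs_count R D T N 1 (a + b) D0 isT (lexx 1) a2.
exists (2 * D.+1%:R * (4 * D.+1%:R + 3) ^+ D * C).
  by rewrite !mulr_ge0// exprn_ge0// addr_ge0// mulr_ge0.
move=> I pos s Q K S sep box K0 s1 Q1 QE Ks SP.
have Kp : 0 < K%:R :> R by rewrite ltr0n.
have sp : 0 < s by lra.
have Qp : 0 < Q by lra.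
have t0 : 0 <= 2 * D.+1%:R * Q by rewrite !mulr_ge0// ltW.
(* P is of order Q, and large enough for [frame_components_le]. *)
pose P := (Num.truncn (2 * D.+1%:R * Q)).+1.
have [P1 P2] : 2 * D.+1%:R * Q <= P%:R /\ P%:R <= 2 * D.+1%:R * Q + 1 :> R.
  have /andP[h1 h2] := truncn_itv t0; split; first exact: ltW.
  by rewrite /P -natr1 lerD2r.
have DP : (D < P)%N.
  rewrite -(ler_nat R); apply: le_trans P1.
  by rewrite mulrAC ler_peMl//; lra.
have Pp : 0 < P%:R :> R by rewrite ltr0n.
pose v (z : I * I) k := pos z.1 k - pos z.2 k.
pose Sw (w : net_index D P) := [set z in S |
  (0 < \sum_k v z k * net_vector R w k) &&
  ((\sum_k v z k ^+ 2) * (\sum_k net_vector R w k ^+ 2) -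
     (\sum_k v z k * net_vector R w k) ^+ 2 <= (\sum_k v z k ^+ 2) * D.+1%:R)].
have cov : (#|S| <= \sum_w #|Sw w|)%N.
  apply: card_cover_le => z zS; have [r8 _ _ _] := SP z zS.
  have v0 : 0 < \sum_k v z k ^+ 2 by rewrite -sqrtr_gt0; apply: lt_le_trans r8.
  have [w [h1 h2]] := exists_net_vector DP v0.
  by exists w; rewrite inE zS h1 h2.
have one w : #|Sw w|%:R <= C * (s ^+ (2 * D.+1) / (K%:R * Q ^+ D)).
  set zv := net_vector R w.
  have n20 : 0 < \sum_k zv k ^+ 2.
    by apply: lt_le_trans (net_vector_sqr_ge R w); rewrite exprn_gt0.
  have [L [LB LN L1]] := exists_frame n20.
  pose X p k := L (pos p) k + D.+1%:R * s.
  have Lb p k : `|L (pos p) k| <= D.+1%:R * s.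
    rewrite -(@ler_pXn2r _ 2)// ?nnegrE ?mulr_ge0 ?(ltW sp)//.
    rewrite real_normK ?num_real//.
    apply: (@le_trans _ _ (\sum_k pos p k ^+ 2)).
      by rewrite -LN (bigD1 k)//= lerDl; apply: sumr_ge0 => j _; exact: sqr_ge0.
    apply: (@le_trans _ _ (\sum_(k < D.+1) s ^+ 2)).
      by apply: ler_sum => j _; have /andP[h1 h2] := box p j; rewrite lerXn2r ?nnegrE ?(ltW sp).
    rewrite sumr_const card_ord -[_ *+ _]mulr_natl exprMn ler_wpM2r ?sqr_ge0//.
    by rewrite expr2 ler_peMl ?ler1n.
  have X0 p k : 0 <= X p k.
    by have := Lb p k; rewrite ler_norml /X => /andP[h _]; rewrite -subr_ge0 in h; rewrite opprK in h.
  have XD p p' k : X p k - X p' k = L (fun j => pos p j - pos p' j) k.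
    by rewrite LB /X; ring.
  pose M := (Num.truncn (2 * N%:R * D.+1%:R * s)).+1.
  have M0 : 0 <= 2 * N%:R * D.+1%:R * s by rewrite !mulr_ge0// ltW.
  have /andP[M1 M2] := truncn_itv M0.
  have XM p k : N%:R * X p k < M%:R.
    apply: le_lt_trans M2; rewrite -!mulrA mulrCA ler_pM2l// /X.
    by have := Lb p k; rewrite ler_norml => /andP[_]; clear; lra.
  have Ms : M%:R <= (a + b) * s.
    have as0 : 0 <= a * s by rewrite mulr_ge0 ?(ltW sp)//; exact: le_trans a1.
    by rewrite /M -natr1 /b; move: M1 s1 as0; clear; lra.
  have Ks' : K%:R * Num.sqrt (K%:R / s) ^+ D <= a + b by move: Ks b0; clear; lra.
  have XI p p' : (forall k, Num.truncn (N%:R * X p k) = Num.truncn (N%:R * X p' k)) -> p = p'.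
    move=> H; apply/eqP/negPn/negP => /sep; rewrite leNgt => /negP; apply.
    have -> : \sum_k (pos p k - pos p' k) ^+ 2 = \sum_k (X p k - X p' k) ^+ 2.
      by rewrite -LN; apply: eq_bigr => k _; rewrite XD.
    exact: (same_cell_dist_lt c0 _ Nc).
  apply: (CP I X s Q K M (fun z => Num.sqrt (\sum_k v z k ^+ 2)) (Sw w)) => // z.
  rewrite inE => /and3P[zS d0 dle].
  have [r8 rQ rK rn] := SP z zS.
  have rr : Num.sqrt (\sum_k v z k ^+ 2) ^+ 2 = \sum_k v z k ^+ 2.
    by rewrite sqr_sqrtr//; apply: sumr_ge0 => k _; exact: sqr_ge0.
  have [v2 Vle] := frame_components_le Q1 P1 (net_vector_sqr_ge R w) (sqrtr_ge0 _) rr d0 dle.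
  have vE : X z.1 ord0 - X z.2 ord0 =
     (\sum_k v z k * zv k) / Num.sqrt (\sum_k zv k ^+ 2) by rewrite XD L1.
  have VE : \sum_k (X z.1 (lift ord0 k) - X z.2 (lift ord0 k)) ^+ 2 =
     \sum_k v z k ^+ 2 - (X z.1 ord0 - X z.2 ord0) ^+ 2.
    have := LN (v z); rewrite big_ord_recl -XD => <-; rewrite addrAC subrr add0r.
    by apply: eq_bigr => k _; rewrite XD.
  cbv zeta; rewrite VE vE; move: v2 Vle r8 rQ rK; rewrite -/zv -/(v z).
  set u := (\sum_k v z k * zv k) / _; set r := Num.sqrt (\sum_k v z k ^+ 2) => v2 Vle r8 rQ rK.
  split=> //.
  - by move: r8 v2; clear; lra.
  - by move: rQ v2; clear; lra.
  - have a0 : 0 <= a by exact: le_trans a1.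
    have aa : a * r <= a * (2 * u) by exact: (ler_wpM2l a0 v2).
    have u0 : 0 <= u by move: r8 v2; clear; lra.
    by have := mulr_ge0 b0 u0; move: rK aa; clear; lra.
  - by split=> //; [exact: sqrtr_ge0 | rewrite rr addrC subrK].
apply: (@le_trans _ _ (\sum_w #|Sw w|%:R)); first by rewrite -natr_sum ler_nat.
apply: le_trans (ler_sum _ (fun w _ => one w)) _.
rewrite sumr_const -[_ *+ _]mulr_natl !card_prod card_ffun card_bool !card_ord.
rewrite !natrM natrX.
have QD : 0 < Q ^+ D by rewrite exprn_gt0.
have PQ : (2 * P).+1%:R ^+ D <= (4 * D.+1%:R + 3) ^+ D * Q ^+ D :> R.
  rewrite -exprMn; apply: lerXn2r; rewrite ?nnegrE//.
    by apply: mulr_ge0 (ltW Qp); rewrite addr_ge0// mulr_ge0.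
  by rewrite -natr1 natrM; move: P2 Q1; clear; lra.
have F0 : 0 <= D.+1%:R * 2 * (C * (s ^+ (2 * D.+1) / (K%:R * Q ^+ D))).
  have sD : 0 <= s ^+ (2 * D.+1) by rewrite exprn_ge0// ltW.
  apply: mulr_ge0 => //; apply: mulr_ge0 => //; apply: divr_ge0 => //.
  exact: mulr_ge0 (ltW Kp) (ltW QD).
have -> : D.+1%:R * 2%:R * (2 * P).+1%:R ^+ D * (C * (s ^+ (2 * D.+1) / (K%:R * Q ^+ D)))
   = D.+1%:R * 2 * (C * (s ^+ (2 * D.+1) / (K%:R * Q ^+ D))) * (2 * P).+1%:R ^+ D by ring.
apply: le_trans (ler_wpM2l F0 PQ) _.
rewrite le_eqVlt; apply/orP; left; apply/eqP.
move: QD; move: (Q ^+ D) (s ^+ _) (_ ^+ D) => q u w q0.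
by field; rewrite !gt_eqF.
Qed.

End FarPairs.

(** * Separated points of a box *)

Section BoxPairs.
Variable R : realType.

(** A pair is determined by the cell of its first point and the difference of the two
    cells. *)
Lemma close_pairs_count (D : nat) (c : R) : 0 < c -> exists2 C : R, 0 <= C &
  forall (I : finType) (pos : I -> 'I_D.+1 -> R) (s H : R) (S : {set I * I}),
  (forall p p', p != p' -> c ^+ 2 <= \sum_k (pos p k - pos p' k) ^+ 2) ->
  (forall p k, 0 <= pos p k <= s) -> 1 <= s -> 1 <= H ->
  (forall z, z \in S -> \sum_k (pos z.1 k - pos z.2 k) ^+ 2 <= H ^+ 2) ->
  #|S|%:R <= C * (s * H) ^+ D.+1.
Proof.
move=> c0; pose N := (Num.bound (D.+1%:R / c ^+ 2)).+1.
have Nc : D.+1%:R / c ^+ 2 < N%:R.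
  apply: lt_trans (archi_boundP _) _; first by rewrite divr_ge0 ?sqr_ge0.
  by rewrite ltr_nat.
have Np : 0 < N%:R :> R by rewrite ltr0n.
exists (((N%:R + 1) * (2 * N%:R + 3)) ^+ D.+1).
  by rewrite exprn_ge0// mulr_ge0// addr_ge0// mulr_ge0.
move=> I pos s H S sep box s1 H1 SP.
have pos0 p k : 0 <= pos p k by have /andP[] := box p k.
pose cell p k := Num.truncn (N%:R * pos p k).
have cellP p k : (cell p k)%:R <= N%:R * pos p k < (cell p k)%:R + 1.
  by rewrite natr1; apply: truncn_itv; rewrite mulr_ge0.
have cell_inj p p' : (forall k, cell p k = cell p' k) -> p = p'.
  move=> h; apply/eqP/negPn/negP => /sep; rewrite leNgt => /negP; apply.
  exact: (same_cell_dist_lt c0 _ Nc).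
have s0 : 0 <= s by exact: le_trans s1.
have H0 : 0 <= H by exact: le_trans H1.
have Ns0 : 0 <= N%:R * s by rewrite mulr_ge0.
have NH0 : 0 <= N%:R * H by rewrite mulr_ge0.
pose M := (Num.truncn (N%:R * s)).+1; pose b := (Num.truncn (N%:R * H)).+1.
have cM p k : (cell p k < M)%N.
  rewrite -(ltr_nat R); have /andP[h _] := cellP p k; apply: le_lt_trans h _.
  have /andP[_] := truncn_itv Ns0; apply: le_lt_trans.
  by rewrite ler_pM2l//; have /andP[] := box p k.
have bd z k : z \in S -> (cell z.2 k + b - cell z.1 k < 2 * b + 1)%N /\
    (cell z.1 k <= cell z.2 k + b)%N.
  move=> zS.
  have d : `|pos z.1 k - pos z.2 k| <= H.
    rewrite -(@ler_pXn2r _ 2)// ?nnegrE// real_normK ?num_real//.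
    apply: le_trans (SP z zS); rewrite (bigD1 k)//= lerDl.
    by apply: sumr_ge0 => j _; exact: sqr_ge0.
  have d2 := ler_wpM2l (ltW Np) d.
  rewrite -{1}(gtr0_norm Np) -normrM mulrBr ler_norml in d2.
  have /andP[h1 h2] := cellP z.1 k; have /andP[h3 h4] := cellP z.2 k.
  have /andP[h5 h6] := d2; have /andP[_ h7] := truncn_itv NH0.
  have e1 : (cell z.1 k <= cell z.2 k + b)%N.
    by rewrite -ltnS -(ltr_nat R) -natr1 natrD; move: h1 h2 h3 h4 h5 h6 h7; rewrite -/b; clear; lra.
  have e2 : (cell z.2 k <= cell z.1 k + b)%N.
    by rewrite -ltnS -(ltr_nat R) -natr1 natrD; move: h1 h2 h3 h4 h5 h6 h7; rewrite -/b; clear; lra.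
  by split=> //; move: (cell z.1 k) (cell z.2 k) e1 e2; clear; lia.
pose f (z : I * I) : {ffun 'I_D.+1 -> 'I_M} * {ffun 'I_D.+1 -> 'I_(2 * b).+1} :=
  ([ffun k => Ordinal (cM z.1 k)], [ffun k => inord (cell z.2 k + b - cell z.1 k)]).
have fI : {in S &, injective f}.
  move=> z z' zS zS' [/ffunP h1 /ffunP h2].
  have e1 k : cell z.1 k = cell z'.1 k by have := congr1 val (h1 k); rewrite !ffunE.
  have e2 k : cell z.2 k = cell z'.2 k.
    have := congr1 val (h2 k); rewrite !ffunE /=.
    have [b1 c1] := bd z k zS; have [b2 c2] := bd z' k zS'.
    rewrite addn1 in b1 b2; rewrite !inordK//.
    move: c1 c2; rewrite e1.
    by move: (cell z'.1 k) (cell z.2 k) (cell z'.2 k); clear; lia.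
  have pE := cell_inj _ _ e1; have qE := cell_inj _ _ e2.
  by case: (z) (z') pE qE => [? ?] [? ?] /= -> ->.
have card1 : (#|S| <= M ^ D.+1 * (2 * b).+1 ^ D.+1)%N.
  rewrite -(card_in_imset fI); apply: leq_trans (max_card _) _.
  by rewrite card_prod !card_ffun !card_ord.
apply: le_trans (_ : (M ^ D.+1 * (2 * b).+1 ^ D.+1)%:R <= _); first by rewrite ler_nat.
have N3 : 0 <= 2 * N%:R + 3 :> R by rewrite addr_ge0// mulr_ge0.
have NN : 0 <= (N%:R + 1) * (2 * N%:R + 3) :> R by rewrite mulr_ge0// addr_ge0.
have sH : 0 <= s * H by rewrite mulr_ge0.
rewrite natrM !natrX -!exprMn; apply: lerXn2r; rewrite ?nnegrE.
- exact: mulr_ge0.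
- exact: mulr_ge0.
have M1 : M%:R <= (N%:R + 1) * s.
  rewrite /M -natr1; have /andP[h _] := truncn_itv Ns0; move: h s1; clear; lra.
have B1 : (2 * b).+1%:R <= (2 * N%:R + 3) * H.
  rewrite -natr1 natrM /b -natr1; have /andP[h _] := truncn_itv NH0.
  move: h H1; clear; lra.
have -> : (N%:R + 1) * (2 * N%:R + 3) * (s * H) = ((N%:R + 1) * s) * ((2 * N%:R + 3) * H).
  by ring.
exact: ler_pM.
Qed.

Lemma exists_root (D : nat) (x : R) : 0 <= x -> exists2 H, 0 <= H & H ^+ D.+1 = x.
Proof.
move=> x0; exists (x `^ (D.+1%:R^-1)); first exact: powR_ge0.
by rewrite -powR_mulrn ?powR_ge0// -powRrM mulVf ?pnatr_eq0// powRr1.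
Qed.

(** The pairs not covered by the trivial bound are distant enough for
    [far_pairs_count]. The hypothesis K^(D+2) <= a^2 s^D enters in all three bounds:
    K <= r follows from it directly, 8 <= r from K <= r, and 2Q <= r, that is
    16 K s <= r^4, from r^2 K >= 4 a^3 s^2 and K <= a^2 s. *)
Lemma far_pair_bounds (D K : nat) (a s r Q W : R) :
  (0 < D)%N -> (0 < K)%N -> 1 <= a -> 1 <= s -> 0 <= r -> 0 <= Q ->
  Q ^+ 4 = K%:R * s -> K%:R ^+ D.+2 <= a ^+ 2 * s ^+ D -> r <= D.+1%:R * s ->
  8 ^+ D.+2 <= W -> a ^+ 2 <= W -> 4 * a ^+ 3 * D.+1%:R ^+ D.+1 <= W ->
  W * s ^+ D.+1 <= r ^+ D.+1 * K%:R ->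
  [/\ 8 <= r, 2 * Q <= r & K%:R <= r].
Proof.
move=> D0 K0 a1 s1 r0 Q0 QE Ka rs W8 Wa WD far.
have Kp : 0 < K%:R :> R by rewrite ltr0n.
have s0 : 0 < s by lra.
have a0 : 0 < a by lra.
have sD : 1 <= s ^+ D by rewrite exprn_ege1.
have Kr : K%:R <= r.
  rewrite -(@ler_pXn2r _ D.+1)// ?nnegrE ?(ltW Kp)// -(ler_pM2r Kp) -exprSr.
  apply: le_trans Ka _; apply: le_trans far.
  apply: ler_pM; rewrite ?sqr_ge0 ?exprn_ge0 ?(ltW s0)//.
  by rewrite exprS ler_peMl// exprn_ge0// ltW.
have r8 : 8 <= r.
  rewrite -(@ler_pXn2r _ D.+2)// ?nnegrE//.
  apply: le_trans W8 _; rewrite exprSr; apply: (@le_trans _ _ (r ^+ D.+1 * K%:R)).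
    apply: le_trans far; rewrite ler_peMr ?exprn_ege1//.
    by apply: le_trans Wa; rewrite sqr_ge0.
  by rewrite ler_wpM2l// exprn_ge0.
split=> //.
have rp : 0 < r by lra.
have Ks : K%:R <= a ^+ 2 * s.
  rewrite -(@ler_pXn2r _ D.+2)// ?nnegrE ?(ltW Kp) ?mulr_ge0 ?(ltW a0) ?(ltW s0)//.
  apply: le_trans Ka _; rewrite exprMn; apply: ler_pM.
  - by rewrite sqr_ge0.
  - by rewrite exprn_ge0// ltW.
  - by rewrite -[leLHS]expr1 ler_weXn2l// exprn_ege1.
  - by rewrite ler_weXn2l// -addn2 leq_addr.
have r2 : 4 * a ^+ 3 * s ^+ 2 <= r ^+ 2 * K%:R.
  have D1 : 0 < D.+1%:R ^+ D.+1 :> R by rewrite exprn_gt0.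
  have sD1 : 0 < s ^+ D.-1 by rewrite exprn_gt0.
  have DE : D.+1 = (2 + D.-1)%N by case: (D) D0.
  rewrite -(ler_pM2r sD1) -(ler_pM2r D1).
  have -> : 4 * a ^+ 3 * s ^+ 2 * s ^+ D.-1 * D.+1%:R ^+ D.+1 =
     4 * a ^+ 3 * D.+1%:R ^+ D.+1 * s ^+ D.+1.
    by rewrite [in s ^+ D.+1]DE exprD; ring.
  apply: le_trans (ler_wpM2r (exprn_ge0 _ (ltW s0)) WD) _; apply: le_trans far _.
  have -> : r ^+ 2 * K%:R * s ^+ D.-1 * D.+1%:R ^+ D.+1 =
     (r ^+ 2 * (s ^+ D.-1 * D.+1%:R ^+ D.+1)) * K%:R by ring.
  rewrite ler_pM2r// DE exprD ler_wpM2l ?sqr_ge0//.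
  apply: (@le_trans _ _ ((D.+1%:R * s) ^+ D.-1)).
    by rewrite lerXn2r ?nnegrE ?mulr_ge0 ?(ltW s0).
  rewrite exprMn mulrC ler_wpM2l ?(ltW sD1)// -DE ler_weXn2l ?ler1n//.
  exact: leq_trans (leq_pred _) (leqnSn _).
rewrite -(@ler_pXn2r _ 4)// ?nnegrE ?mulr_ge0// exprMn QE.
have K2 : 0 < K%:R ^+ 2 :> R by rewrite exprn_gt0.
rewrite -(ler_pM2r K2).
have -> : r ^+ 4 * K%:R ^+ 2 = (r ^+ 2 * K%:R) ^+ 2 by ring.
apply: (@le_trans _ _ ((4 * a ^+ 3 * s ^+ 2) ^+ 2)); last first.
  by rewrite lerXn2r ?nnegrE ?mulr_ge0 ?exprn_ge0 ?(ltW s0) ?(ltW a0) ?(ltW Kp).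
have -> : 2 ^+ 4 * (K%:R * s) * K%:R ^+ 2 = (16 * s) * K%:R ^+ 3 by ring.
have -> : (4 * a ^+ 3 * s ^+ 2) ^+ 2 = (16 * s) * (a ^+ 2 * s) ^+ 3 by ring.
rewrite ler_pM2l ?mulr_gt0// lerXn2r ?nnegrE ?(ltW Kp)//.
by rewrite mulr_ge0 ?sqr_ge0 ?(ltW s0) ?(ltW a0).
Qed.

(** Pairs at distance r with r^(D+1) K < W s^(D+1) are so few that all of them may be
    counted; the others are distant in the sense of [far_pairs_count]. *)
Lemma box_pairs_count (D T : nat) (c a : R) : (0 < D)%N -> 0 < c -> 2 <= a ->
  exists2 C : R, 0 <= C &
  forall (I : finType) (pos : I -> 'I_D.+1 -> R) (s : R) (K : nat),
  (forall p p', p != p' -> c ^+ 2 <= \sum_k (pos p k - pos p' k) ^+ 2) ->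
  (forall p k, 0 <= pos p k <= s) ->
  (0 < K)%N -> 1 <= s -> K%:R ^+ D.+2 <= a ^+ 2 * s ^+ D ->
  #|[set z : I * I | asbool (near_int (T%:R / K%:R)
       (Num.sqrt (\sum_k (pos z.1 k - pos z.2 k) ^+ 2)))]|%:R
    <= C * (s ^+ (2 * D.+1) / K%:R).
Proof.
move=> D0 c0 a2; have a1 : 1 <= a by lra.
have a0 : 0 < a by lra.
have [C1 C10 CP1] := far_pairs_count T D0 c0 a1.
have [C2 C20 CP2] := close_pairs_count D c0.
pose W := 8 ^+ D.+2 + (a ^+ 2 + 4 * a ^+ 3 * D.+1%:R ^+ D.+1).
have p1 : 0 <= 8 ^+ D.+2 :> R by rewrite exprn_ge0.
have p2 : 0 <= a ^+ 2 by rewrite sqr_ge0.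
have p3 : 0 <= 4 * a ^+ 3 * D.+1%:R ^+ D.+1.
  by rewrite !mulr_ge0 ?exprn_ge0// ltW.
have W8 : 8 ^+ D.+2 <= W by rewrite /W; move: p2 p3; clear; lra.
have Wa : a ^+ 2 <= W by rewrite /W; move: p1 p3; clear; lra.
have WD : 4 * a ^+ 3 * D.+1%:R ^+ D.+1 <= W by rewrite /W; move: p1 p2; clear; lra.
have W0 : 0 <= W by exact: le_trans W8.
exists (C1 + C2 * W); first by rewrite addr_ge0 ?mulr_ge0.
move=> I pos s K sep box K0 s1 Ka.
have Kp : 0 < K%:R :> R by rewrite ltr0n.
have s0 : 0 < s by lra.
set S := [set z | _].
pose r (z : I * I) := Num.sqrt (\sum_k (pos z.1 k - pos z.2 k) ^+ 2).
have r2 z : r z ^+ 2 = \sum_k (pos z.1 k - pos z.2 k) ^+ 2.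
  by rewrite sqr_sqrtr//; apply: sumr_ge0 => k _; exact: sqr_ge0.
pose far (z : I * I) := W * s ^+ D.+1 <= r z ^+ D.+1 * K%:R.
have Ks : K%:R <= a ^+ 2 * s ^+ D.+1.
  have K1 : 1 <= K%:R :> R by rewrite ler1n.
  apply: (@le_trans _ _ (K%:R ^+ D.+2)).
    by rewrite -[leLHS]expr1 ler_weXn2l.
  apply: le_trans Ka _; rewrite ler_wpM2l ?sqr_ge0// exprS ler_peMl// exprn_ge0//.
  exact: ltW.
have Q0 : 0 <= Num.sqrt (Num.sqrt (K%:R * s)) by exact: sqrtr_ge0.
have QE : Num.sqrt (Num.sqrt (K%:R * s)) ^+ 4 = K%:R * s.
  by rewrite -[4%N]/(2 * 2)%N exprM !sqr_sqrtr ?sqrtr_ge0 ?mulr_ge0 ?(ltW s0).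
set Q := Num.sqrt _ in Q0 QE.
have Q1 : 1 <= Q.
  rewrite -(@ler_pXn2r _ 4)// ?nnegrE// expr1n QE.
  by apply: le_trans s1 _; rewrite ler_peMl ?(ltW s0)// ler1n.
have Ks2 : K%:R * Num.sqrt (K%:R / s) ^+ D <= a.
  rewrite -(@ler_pXn2r _ 2)// ?nnegrE ?mulr_ge0 ?exprn_ge0 ?sqrtr_ge0 ?(ltW a0)//.
  rewrite exprMn -exprM mulnC exprM sqr_sqrtr ?divr_ge0 ?(ltW s0)// expr_div_n mulrA.
  rewrite -exprD ler_pdivrMr ?exprn_gt0//; exact: Ka.
have F1 : #|S :&: [set z | far z]|%:R <= C1 * (s ^+ (2 * D.+1) / K%:R).
  apply: (CP1 I pos s Q K) => // z; rewrite !inE => /andP[/asboolP zn zf].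
  have rs : r z <= D.+1%:R * s.
    rewrite -(@ler_pXn2r _ 2)// ?nnegrE ?sqrtr_ge0 ?mulr_ge0 ?(ltW s0)// r2.
    apply: (@le_trans _ _ (\sum_(k < D.+1) s ^+ 2)).
      apply: ler_sum => k _; have /andP[h1 h2] := box z.1 k; have /andP[h3 h4] := box z.2 k.
      rewrite -real_normK ?num_real// lerXn2r ?nnegrE ?(ltW s0)//.
      by rewrite ler_norml; move: h1 h2 h3 h4; clear => *; apply/andP; split; lra.
    rewrite sumr_const card_ord -[_ *+ _]mulr_natl exprMn ler_wpM2r ?sqr_ge0//.
    by rewrite expr2 ler_peMl ?ler1n.
  have [e1 e2 e3] := far_pair_bounds D0 K0 a1 s1 (sqrtr_ge0 _) Q0 QE Ka rs W8 Wa WD zf.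
  split=> //; apply: (@le_trans _ _ (2 * r z)); first by rewrite ler_pM2l.
  by rewrite ler_wpM2r// sqrtr_ge0.
have x0 : 0 <= W * s ^+ D.+1 / K%:R.
  by rewrite divr_ge0 ?mulr_ge0 ?exprn_ge0 ?(ltW s0).
have [H H0 HE] := exists_root D x0.
have H1 : 1 <= H.
  rewrite -(@ler_pXn2r _ D.+1)// ?nnegrE// expr1n HE ler_pdivlMr// mul1r.
  by apply: le_trans Ks _; rewrite ler_wpM2r// exprn_ge0// ltW.
have F2 : #|S :&: [set z | ~~ far z]|%:R <= C2 * (s * H) ^+ D.+1.
  apply: (CP2 I pos s H) => // z; rewrite !inE => /andP[_ zf].
  rewrite -r2 lerXn2r ?nnegrE ?sqrtr_ge0//.
  rewrite -(@ler_pXn2r _ D.+1)// ?nnegrE ?sqrtr_ge0// HE ler_pdivlMr//.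
  by move: zf; rewrite /far -ltNge => /ltW.
have SE : (#|S| <= #|S :&: [set z | far z]| + #|S :&: [set z | ~~ far z]|)%N.
  rewrite -(cardsID [set z | far z] S) leq_add2l; apply: subset_leq_card.
  by apply/fintype.subsetP => z; rewrite !inE => /andP[-> ->].
apply: (@le_trans _ _ (C1 * (s ^+ (2 * D.+1) / K%:R) + C2 * (s * H) ^+ D.+1)).
  by apply: le_trans (lerD F1 F2); rewrite -natrD ler_nat.
rewrite exprMn HE mul2n -addnn exprD le_eqVlt; apply/orP; left; apply/eqP.
by move: (s ^+ D.+1) => u; field; rewrite gt_eqF.
Qed.

End BoxPairs.

(** * Points spread over unit cubes *)

Section SpreadPoints.
Variable R : realType.

Lemma expr_sub_le (s x : R) n : 0 <= x -> x <= s ->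
  s ^+ n.+1 - x ^+ n.+1 <= n.+1%:R * (s - x) * s ^+ n.
Proof.
move=> x0 xs; elim: n => [|n IH]; first by rewrite expr0 !expr1 mul1r mulr1.
have s0 : 0 <= s by exact: le_trans xs.
have -> : s ^+ n.+2 - x ^+ n.+2 = s * (s ^+ n.+1 - x ^+ n.+1) + (s - x) * x ^+ n.+1.
  by rewrite [s ^+ n.+2]exprS [x ^+ n.+2]exprS; ring.
have h1 := ler_wpM2l s0 IH.
have h2 : (s - x) * x ^+ n.+1 <= (s - x) * s ^+ n.+1.
  by rewrite ler_wpM2l ?subr_ge0// lerXn2r ?nnegrE.
apply: le_trans (lerD h1 h2) _; rewrite le_eqVlt; apply/orP; left; apply/eqP.
by rewrite -[n.+2%:R]natr1 [s ^+ n.+1]exprS; ring.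
Qed.

(** The cubes with corners in {0, ..., M-1}^(D+1), where M is the integral part of s, supply
    M^(D+1) distinct points of the box, and s^(D+1) - M^(D+1) <= (D+1) s^D. *)
Lemma card_outside_box_le (D : nat) (I : finType) (pos : I -> 'I_D.+1 -> R) (s : R) :
  1 <= s -> s ^+ D.+1 = #|I|%:R ->
  (forall f : {ffun 'I_D.+1 -> 'I_(Num.truncn s)},
     exists p, forall k, (f k)%:R <= pos p k < (f k)%:R + 1) ->
  #|[set p | ~~ [forall k, 0 <= pos p k <= s]]|%:R <= D.+1%:R * s ^+ D.
Proof.
move=> s1 sn cub; set M := Num.truncn s in cub *.
have s0 : 0 <= s by exact: le_trans s1.
have /andP[M1 M2] := truncn_itv s0; rewrite -/M -natr1 in M1 M2.
have [F FP] := choice cub.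
have FI : injective F.
  move=> f g fg; apply/ffunP => k; apply: val_inj; apply/eqP => /=.
  have /andP[h1 h2] := FP f k; have /andP[h3 h4] := FP g k.
  rewrite fg in h1 h2.
  have e1 : (f k <= g k)%N by rewrite -ltnS -(ltr_nat R) -natr1; apply: le_lt_trans h1 h4.
  have e2 : (g k <= f k)%N by rewrite -ltnS -(ltr_nat R) -natr1; apply: le_lt_trans h3 h2.
  by rewrite eqn_leq e1.
set inn := [set p | [forall k, 0 <= pos p k <= s]].
have Minn : (M ^ D.+1 <= #|inn|)%N.
  rewrite -[X in (X ^ _ <= _)%N]card_ord -[X in (_ ^ X <= _)%N]card_ord -card_ffun.
  rewrite -(card_imset predT FI) -[leqLHS]cardsE; apply: subset_leq_card.
  apply/fintype.subsetP => p; rewrite !inE => /imsetP[f _ ->].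
  apply/forallP => k; have /andP[h1 h2] := FP f k.
  apply/andP; split; first by apply: le_trans h1.
  apply: le_trans (ltW h2) _; apply: le_trans M1; rewrite natr1 ler_nat; exact: ltn_ord.
have -> : #|[set p | ~~ [forall k, 0 <= pos p k <= s]]|%:R = s ^+ D.+1 - #|inn|%:R.
  have -> : [set p | ~~ [forall k, 0 <= pos p k <= s]] = ~: inn by apply/setP => p; rewrite !inE.
  by rewrite sn -(cardsC inn) natrD addrC addKr.
apply: (@le_trans _ _ (s ^+ D.+1 - M%:R ^+ D.+1)).
  by rewrite lerD2l lerN2 -natrX ler_nat.
apply: le_trans (expr_sub_le _ _ M1) _ => //.
rewrite ler_wpM2r ?exprn_ge0// ler_piMr//; move: M2; clear; lra.
Qed.

(** [box_pairs_count] for the points of the box; the O(n/s) other ones form at most O(n^2/s)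
    pairs. *)
Lemma spread_pairs_count (D T : nat) (c a : R) : (0 < D)%N -> 0 < c -> 2 <= a ->
  exists2 C : R, 0 <= C &
  forall (I : finType) (pos : I -> 'I_D.+1 -> R) (s : R) (K : nat),
  (forall p p', p != p' -> c ^+ 2 <= \sum_k (pos p k - pos p' k) ^+ 2) ->
  1 <= s -> s ^+ D.+1 = #|I|%:R ->
  (forall f : {ffun 'I_D.+1 -> 'I_(Num.truncn s)},
     exists p, forall k, (f k)%:R <= pos p k < (f k)%:R + 1) ->
  (0 < K)%N -> K%:R ^+ D.+2 <= a ^+ 2 * s ^+ D ->
  #|[set z : I * I | asbool (near_int (T%:R / K%:R)
       (Num.sqrt (\sum_k (pos z.1 k - pos z.2 k) ^+ 2)))]|%:R
    <= C * (#|I|%:R ^+ 2 * (K%:R^-1 + s^-1)).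
Proof.
move=> D0 c0 a2; have [C C0 CP] := @box_pairs_count R D T c a D0 c0 a2.
exists (C + 2 * D.+1%:R); first by rewrite addr_ge0// mulr_ge0.
move=> I pos s K sep s1 sn cub K0 Ka.
have Kp : 0 < K%:R :> R by rewrite ltr0n.
have sp : 0 < s by lra.
pose out := [set p | ~~ [forall k, 0 <= pos p k <= s]].
have outP : #|out|%:R <= D.+1%:R * s ^+ D by exact: card_outside_box_le.
pose J := {p : I | [forall k, 0 <= pos p k <= s]}.
pose posJ (p : J) := pos (val p).
have sepJ (p p' : J) : p != p' -> c ^+ 2 <= \sum_k (posJ p k - posJ p' k) ^+ 2.
  by move=> pp; apply: sep; rewrite (inj_eq val_inj).
have boxJ (p : J) k : 0 <= posJ p k <= s by have /forallP/(_ k) := valP p.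
have := CP J posJ s K sepJ boxJ K0 s1 Ka.
set SJ := [set z : J * J | _] => SJP; set S := [set z : I * I | _].
have cov : (#|S| <= #|SJ| + (#|out| * #|I| + #|I| * #|out|))%N.
  pose f (z : J * J) := (val z.1, val z.2).
  have sub : S \subset f @: SJ :|: (finset.setX out (finset.setTfor I) :|: finset.setX (finset.setTfor I) out).
    apply/fintype.subsetP => -[p q]; rewrite !inE /= => pq.
    case: (boolP [forall k, 0 <= pos p k <= s]) => pi; last by rewrite orbT.
    case: (boolP [forall k, 0 <= pos q k <= s]) => qi; last by rewrite !orbT.
    apply/orP; left; apply/imsetP; exists (exist _ p pi, exist _ q qi) => //.
    by rewrite inE; apply/asboolP.
  apply: leq_trans (subset_leq_card sub) _.
  apply: leq_trans (leq_card_setU _ _) _; apply: leq_add; first exact: leq_imset_card.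
  by apply: leq_trans (leq_card_setU _ _) _; rewrite !cardsX cardsT.
have n0 : 0 <= #|I|%:R :> R by [].
have covR : #|S|%:R <= #|SJ|%:R + 2 * (#|I|%:R * #|out|%:R) :> R.
  have -> : 2 * (#|I|%:R * #|out|%:R) = (#|out| * #|I| + #|I| * #|out|)%:R :> R.
    by rewrite natrD !natrM; ring.
  by rewrite -natrD ler_nat.
apply: le_trans covR _.
have e1 := ler_wpM2l n0 outP.
have e2 : s ^+ (2 * D.+1) / K%:R = #|I|%:R ^+ 2 / K%:R by rewrite mulnC exprM sn.
have e3 : #|I|%:R * (D.+1%:R * s ^+ D) = D.+1%:R * (#|I|%:R ^+ 2 / s).
  by rewrite -sn exprS; field; rewrite gt_eqF.
rewrite e2 in SJP; rewrite e3 in e1.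
have p1 : 0 <= #|I|%:R ^+ 2 / K%:R :> R by apply: divr_ge0 => //; exact: exprn_ge0.
have p2 : 0 <= #|I|%:R ^+ 2 / s by apply: divr_ge0; [exact: exprn_ge0 | exact: ltW].
have p3 := mulr_ge0 C0 p2.
have p4 : 0 <= D.+1%:R * (#|I|%:R ^+ 2 / K%:R) :> R by exact: mulr_ge0.
rewrite mulrDr; move: SJP e1 p1 p2 p3 p4.
move: (#|I|%:R ^+ 2 / K%:R) (#|I|%:R ^+ 2 / s) => u v.
by clear; lra.
Qed.

Lemma powRX (x r : R) k : (x `^ r) ^+ k = x `^ (r * k%:R).
Proof. by rewrite powRrM powR_mulrn ?powR_ge0. Qed.

End SpreadPoints.

(** * The theorem *)

Unset Implicit Arguments.
Unset Strict Implicit.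
Unset Printing Implicit Defensive.
Local Open Scope fset_scope.
Local Open Scope classical_set_scope.
Local Open Scope ring_scope.

Theorem theorem1p6 (R : realType) (d : nat) (hd : (2 <= d)%N) (c : R)
    (hc : 0 < c) :
  exists C : R, forall (n : nat) (P : {fset 'rV[R]_d}),
    #|` P| = n -> well_distributed c P ->
    (#|` [fset q in P `*` P |
          (dist_int (euclidean_norm (q.1 - q.2))
            < n%:R `^ (- ((d%:R - 1) / (d%:R * (d%:R + 1)))))%R ]%fset|)%:R
      <= C * n%:R `^ (2 - 2 / (d%:R + 1) + 1 / d%:R)
    /\
    C * n%:R `^ (2 - 2 / (d%:R + 1) + 1 / d%:R)
      = C * n%:R `^ (2 - 1 / d%:R) * n%:R `^ (2 / (d%:R * (d%:R + 1))).
Proof.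
case: d hd => [//|D] D0; pose a : R := 2 ^+ D.+2.
have a2 : 2 <= a by rewrite /a exprS ler_peMr// exprn_ege1// ler1n.
have [C C0 CP] := @spread_pairs_count R D 2 c a D0 hc a2.
have d0 : 0 < D.+1%:R :> R by rewrite ltr0n.
have d1 : 0 < D.+1%:R + 1 :> R by rewrite addr_gt0.
have dd : 2 <= D.+1%:R :> R by rewrite ler_nat.
set e := (D.+1%:R - 1) / (D.+1%:R * (D.+1%:R + 1)).
set E := 2 - 2 / (D.+1%:R + 1) + 1 / D.+1%:R.
have EE : E = 2 - e by rewrite /E /e; field; rewrite !gt_eqF.
have e0 : 0 <= e.
  by apply: divr_ge0; [lra | exact: mulr_ge0 (ltW d0) (ltW d1)].
have e1 : e <= D.+1%:R^-1.
  have -> : e = D.+1%:R^-1 * ((D.+1%:R - 1) / (D.+1%:R + 1)) by rewrite /e; field; rewrite !gt_eqF.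
  apply: ler_piMr; first by rewrite invr_ge0 ltW.
  by rewrite ler_pdivrMr// mul1r; lra.
have ehalf : D.+1%:R^-1 <= 2^-1 :> R by rewrite lef_pV2 ?posrE//.
have E0 : E != 0.
  have e2 := le_trans e1 ehalf; rewrite EE gt_eqF// subr_gt0.
  by apply: le_lt_trans e2 _; lra.
(* The last two terms of [spread_pairs_count], 1/K and 1/s, are both at most del. *)
exists (C * 2) => n P Pn wd; split; last first.
  rewrite -[RHS]mulrA -powRD.
    by congr (_ * _ `^ _); rewrite /E; field; rewrite !gt_eqF.
  apply/implyP => /eqP h; exfalso; move: E0; apply/negP; rewrite negbK.
  by apply/eqP; rewrite -[RHS]h /E; field; rewrite !gt_eqF.
have [n0|n0] := posnP n.
  have -> : P = fset0 by apply/eqP; rewrite -cardfs_eq0 Pn n0.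
  set F := (X in #|` X|); have -> : F = fset0 by apply/fsetP => q; rewrite !inE.
  by rewrite n0 cardfs0 powR0// mulr0.
have np : 0 < n%:R :> R by rewrite ltr0n.
have n1 : 1 <= n%:R :> R by rewrite ler1n.
have [sep cub] := wd; rewrite Pn in cub.
set s := n%:R `^ D.+1%:R^-1 in cub; set del := n%:R `^ (- e).
have sE : s ^+ D.+1 = n%:R.
  by rewrite -powR_mulrn ?powR_ge0// -powRrM mulVf ?gt_eqF// powRr1// ltW.
have s1 : 1 <= s by rewrite -(powRr0 n%:R) ler_powR// invr_ge0.
have sp : 0 < s by exact: lt_le_trans s1.
have dp : 0 < del by exact: powR_gt0.
have del1 : del <= 1 by rewrite -[leRHS](powRr0 n%:R) ler_powR// oppr_le0.
have sdel : s^-1 <= del by rewrite -powRN ler_powR// lerN2.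
(* K is of order 1 / del, and del^-(D+2) = s^D. *)
pose K := (Num.truncn del^-1).+1.
have /andP[K1 K2] : (Num.truncn del^-1)%:R <= del^-1 < K%:R.
  by apply: truncn_itv; rewrite invr_ge0 ltW.
have Kp : 0 < K%:R :> R by rewrite ltr0n.
have del2 : del <= 2 / K%:R.
  rewrite ler_pdivlMr// -ler_pdivlMl// /K -natr1.
  have : 1 <= del^-1 by rewrite invf_ge1.
  by move: K1; clear; lra.
have Kdel : K%:R^-1 <= del by rewrite invf_ple ?posrE//; exact: ltW.
have Ka : K%:R ^+ D.+2 <= a ^+ 2 * s ^+ D.
  apply: (@le_trans _ _ ((2 / del) ^+ D.+2)).
    rewrite lerXn2r ?nnegrE ?divr_ge0 ?(ltW dp)//.
    by rewrite ler_pdivlMr// mulrC -ler_pdivlMr.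
  have -> : (2 / del) ^+ D.+2 = a * s ^+ D.
    rewrite exprMn -/a; suff -> : (del^-1) ^+ D.+2 = s ^+ D by [].
    rewrite -powRN opprK !powRX.
    suff -> : e * D.+2%:R = D.+1%:R^-1 * D%:R by [].
    rewrite /e -[D.+2%:R]natr1 -[D.+1%:R]natr1.
    have Dp : 0 <= D%:R :> R by [].
    by field; rewrite !gt_eqF//; lra.
  rewrite ler_wpM2r ?exprn_ge0 ?(ltW sp)// expr2 ler_peMr//; lra.
pose pos (p : P) k := (val p) ord0 k.
have cardP : #|{: P}| = n by rewrite -cardfE.
have sepI (p p' : P) : p != p' -> c ^+ 2 <= \sum_k (pos p k - pos p' k) ^+ 2.
  move=> pp; have := sep _ _ (valP p) (valP p').
  rewrite (inj_eq val_inj) => /(_ pp); rewrite /euclidean_norm => h.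
  have h2 : c ^+ 2 <= Num.sqrt (\sum_(i < D.+1) ((val p - val p') ord0 i) ^+ 2) ^+ 2.
    by rewrite lerXn2r ?nnegrE ?sqrtr_ge0 ?(ltW hc).
  rewrite sqr_sqrtr in h2; last by apply: sumr_ge0 => k _; exact: sqr_ge0.
  by apply: le_trans h2 _; apply: ler_sum => k _; rewrite !mxE.
have cubI (f : {ffun 'I_D.+1 -> 'I_(Num.truncn s)}) :
    exists p : P, forall k, (f k)%:R <= pos p k < (f k)%:R + 1.
  pose z : 'rV[int]_D.+1 := \row_k (f k)%:Z.
  have /andP[s2 _] := truncn_itv (ltW sp).
  have zbox : (unit_lattice_cube z : set 'rV[R]_D.+1) `<=` closed_box s.
    move=> x xz k; have := xz k; rewrite mxE -[((f k)%:Z)%:~R]/((f k)%:R) => /andP[h1 h2].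
    apply/andP; split; first exact: le_trans h1.
    apply: le_trans (ltW h2) _; apply: le_trans s2.
    by rewrite natr1 ler_nat; exact: ltn_ord.
  have [p [[pP pz] _]] := cub z zbox.
  by exists [` pP] => k; have := pz k; rewrite mxE.
have sE' : s ^+ D.+1 = #|{: P}|%:R by rewrite cardP.
have := CP P pos s K sepI s1 sE' cubI isT Ka; rewrite cardP.
set S := (X in #|X|%:R <= _) => SP.
set F := (X in #|` X|).
have FP (x : F) : [/\ (val x).1 \in P, (val x).2 \in P &
    dist_int (euclidean_norm ((val x).1 - (val x).2)) < del].
  by have := valP x; rewrite !inE /= => /andP[/andP[-> ->] ->].
pose g (x : F) : P * P := ([` let: And3 h _ _ := FP x in h], [` let: And3 _ h _ := FP x in h]).
have gI : injective g.
  move=> x y [h1 h2]; apply: val_inj => /=.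
  by rewrite (surjective_pairing (val x)) (surjective_pairing (val y)) h1 h2.
have FS : (#|` F| <= #|S|)%N.
  rewrite cardfE -(card_imset predT gI) -[leqLHS]cardsE; apply: subset_leq_card.
  apply/fintype.subsetP => z; rewrite !inE => /imsetP[x _ ->].
  apply/asboolP; have [_ _ dx] := FP x.
  have ne : [set `|euclidean_norm ((val x).1 - (val x).2) - m%:~R| | m in [set: int]] !=set0.
    by exists `|euclidean_norm ((val x).1 - (val x).2) - (0 : int)%:~R|; exists 0.
  have [r [m _ <-] rdel] := inf_lt ne dx.
  apply/asboolP; exists m; apply: le_trans del2; apply: le_trans (ltW rdel).
  rewrite le_eqVlt; apply/orP; left; apply/eqP; rewrite /euclidean_norm.
  congr (`|Num.sqrt _ - _|); apply: eq_bigr => k _; by rewrite !mxE.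
apply: (@le_trans _ _ #|S|%:R); first by rewrite ler_nat.
apply: le_trans SP _; rewrite -mulrA ler_wpM2l//.
have -> : n%:R `^ E = n%:R ^+ 2 * del.
  rewrite EE powRD; first by rewrite powR_mulrn// ltW.
  by rewrite (gt_eqF np) implybT.
have : n%:R ^+ 2 * (K%:R^-1 + s^-1) <= n%:R ^+ 2 * (2 * del) :> R.
  by rewrite ler_wpM2l ?sqr_ge0//; lra.
by clear; lra.
Qed.
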